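(* Let $\sigma$ be a proper primitive pseudo-unimodular substitution over a finite alphabet $A$, with incidence matrix $M_\sigma$. Assume that the Perron eigenvalue of $M_\sigma$ is a Pisot number $\beta$ of degree $d+1$, and assume that every generalized eigenvector of $M_\sigma$ for every eigenvalue of modulus $\geq 1$ other than $\beta$ has sum zero. Then the subshift $(\Omega_\sigma, S)$ is a finite extension of a minimal translation on the torus $\mathbb{T}^d=\mathbb{R}^d/\mathbb{Z}^d$.
   Context: A substitution over a finite alphabet $A$ is a morphism $\sigma:A^*\to A^*$ of the free monoid with $|\sigma(a)|\ge 1$ for all $a\in A$. Its incidence matrix is $M_\sigma=(|\sigma(a)|_b)_{(b,a)\in A^2}$, where $|\sigma(a)|_b$ is the number of occurrences of $b$ in $\sigma(a)$ (row index $b$, column index $a$). $\sigma$ is primitive if some power $M_\sigma^n$, $n\ge1$, has all entries strictly positive; the Perron eigenvalue is then the simple real eigenvalue equal to the spectral radius. A matrix is pseudo-unimodular if the product of all its non-zero eigenvalues, counted with multiplicity, is $\pm1$; $\sigma$ is pseudo-unimodular if $M_\sigma$ is. $\sigma$ is left-proper (resp. right-proper) if there is a letter $a_0\in A$ such that every $\sigma(a)$, $a\in A$, starts (resp. ends) with $a_0$; it is proper if it is both left-proper and right-proper. A Pisot number is an algebraic integer $\beta>1$ all of whose conjugates $\gamma\neq\beta$ satisfy $|\gamma|<1$; its degree is the degree of its minimal polynomial over $\mathbb{Q}$. A generalized eigenvector of a matrix $M$ for an eigenvalue $\gamma$ is a non-zero complex vector of $\ker((M-\gamma I)^k)$, with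 $k$ the algebraic multiplicity of $\gamma$. The sum of a vector is the sum of its coordinates. $S:A^{\mathbb{Z}}\to A^{\mathbb{Z}}$ is the shift $(u_i)_i\mapsto(u_{i+1})_i$, and $\Omega_\sigma$ is the smallest non-empty compact subset of $A^{\mathbb{Z}}$ invariant under $\sigma$ and $S$. $(\Omega_\sigma,S)$ is an extension of a translation on $\mathbb{T}^d$ if there are a continuous map $f:\Omega_\sigma\to\mathbb{T}^d$ and $\alpha\in\mathbb{T}^d$ with $f\circ S=f+\alpha$; the translation is $x\mapsto x+\alpha$, and it is minimal if all its orbits are dense. The extension is finite if $f^{-1}(x)$ is finite for Lebesgue-almost every $x\in\mathbb{T}^d$. *)

(* Defs.v *)
From HB Require Import structures.
From mathcomp Require Import all_boot all_order all_algebra ring_quotient.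
From mathcomp Require Import complex.
From mathcomp Require Import all_classical all_reals all_analysis.

Set Implicit Arguments.
Unset Strict Implicit.
Unset Printing Implicit Defensive.

Import Order.TTheory GRing.Theory Num.Theory.
Import numFieldNormedType.Exports.

Local Open Scope classical_set_scope.
Local Open Scope ring_scope.
Local Open Scope complex_scope.

(* A morphism of the free monoid is given by the images of the letters. *)
Record substitution (A : finType) := Substitution {
  subst_letter :> A -> seq A;
  subst_nonerasing : forall a, (1 <= size (subst_letter a))%N
}.

Section Substitutions.
Context {A : finType}.
Implicit Types s : substitution A.

Definition incidence_matrix s : 'M[int]_#|A| :=
  \matrix_(b, a) (count_mem (enum_val b) (s (enum_val a)))%:Z.

Definition primitive_subst s :=
  exists2 n, (1 <= n)%N & forall i j, 0 < (incidence_matrix s ^+ n) i j.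

Definition left_proper s := exists a0, forall a, prefix [:: a0] (s a).
Definition right_proper s := exists a0, forall a, suffix [:: a0] (s a).
Definition proper_subst s := left_proper s /\ right_proper s.

End Substitutions.

Section Spectrum.
Context {R : realType} {n : nat}.

Definition complex_mx (M : 'M[int]_n) : 'M[R[i]]_n := map_mx intr M.

(* The eigenvalues, listed with algebraic multiplicity; the list is unique up
   to permutation. *)
Definition spectrum (M : 'M[R[i]]_n) : seq R[i] :=
  sval (closed_field_poly_normal (char_poly M)).

Definition pseudo_unimodular_mx (M : 'M[R[i]]_n) :=
  let p := \prod_(z <- spectrum M | z != 0) z in p = 1 \/ p = -1.

Definition generalized_eigenvector (M : 'M[R[i]]_n) (z : R[i])
    (v : 'cV[R[i]]_n) :=
  v != 0 /\ (M - z%:M) ^+ (mup z (char_poly M)) *m v = 0.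

Definition perron_eigenvalue (M : 'M[R[i]]_n) (beta : R) :=
  [/\ eigenvalue M beta%:C, mup beta%:C (char_poly M) = 1%N &
      forall z, eigenvalue M z -> `|z| <= beta%:C].

End Spectrum.

Definition pseudo_unimodular (R : realType) (A : finType) (s : substitution A) :=
  pseudo_unimodular_mx (complex_mx (R := R) (incidence_matrix s)).

Section Pisot.
Context {R : realType}.

Definition minimal_polynomial (p : {poly rat}) (x : R) :=
  [/\ p \is monic, root (map_poly ratr p) x &
      forall q : {poly rat}, root (map_poly ratr q) x -> p %| q].

Definition algebraic_degree (x : R) (n : nat) :=
  exists2 p, minimal_polynomial p x & size p = n.+1.

Definition conjugate (x : R) (z : R[i]) :=
  exists2 p, minimal_polynomial p x & root (map_poly ratr p) z.

Definition pisot (beta : R) :=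
  [/\ 1 < beta, integralOver (intr : int -> R) beta &
      forall z, conjugate beta z -> z != beta%:C -> `|z| < 1].

End Pisot.

Definition biinfinite (A : finType) :=
  prod_topology (fun _ : int => discrete_topology A).

Section Subshift.
Context {A : finType}.
Implicit Types u : biinfinite A.

Definition shift u : biinfinite A := fun i => u (i + 1).

(* [... s(u_{-2}) s(u_{-1}) . s(u_0) s(u_1) ...], with [s(u_0)] starting at
   position 0.  As [s] is nonerasing, the first [n.+1] images to the right
   (resp. to the left, read backwards) of the origin cover position [n] (resp.
   [Negz n = - n.+1]), so that the default value of [nth] is never reached. *)
Definition subst_biinfinite (s : substitution A) u : biinfinite A := fun i =>
  match i with
  | Posz n =>
      nth (u 0) (flatten [seq s (u (Posz j)) | j <- iota 0 n.+1]) n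
  | Negz n =>
      nth (u 0) (flatten [seq rev (s (u (Negz j))) | j <- iota 0 n.+1]) n
  end.

Definition invariant_compact (s : substitution A) (X : set (biinfinite A)) :=
  [/\ X !=set0, compact X, subst_biinfinite s @` X `<=` X & shift @` X `<=` X].

Definition substitution_subshift (s : substitution A)
    (Omega : set (biinfinite A)) :=
  invariant_compact s Omega /\
  forall X, invariant_compact s X -> Omega `<=` X.

End Subshift.

Section Torus.
Variables (R : realType) (d : nat).

Definition integer_vector : {pred 'rV[R]_d} :=
  fun x => [forall i, x 0 i \is a Num.int].

Fact integer_vector_zmod_closed : zmod_closed integer_vector.
Proof.
split=> [|x y /forallP xZ /forallP yZ].
  by apply/forallP => i; rewrite mxE rpred0.
by apply/forallP => i; rewrite !mxE rpredB.
Qed.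

HB.instance Definition _ :=
  GRing.isZmodClosed.Build 'rV[R]_d integer_vector integer_vector_zmod_closed.

(* R^d / Z^d as a quotient group; the topology added below is the quotient
   topology.  The type [quotient_topology] is not used because its equality
   and choice structures differ from those of the quotient group. *)
Definition torus : Type := Quotient.quot integer_vector.

HB.instance Definition _ := GRing.Zmodule.on torus.
HB.instance Definition _ := EqQuotient.on torus.

Definition torus_open : set_system torus :=
  [set U | open (\pi_torus%qT @^-1` U : set 'rV[R]_d)].

Fact torus_openT : torus_open setT.
Proof. by rewrite /torus_open /= preimage_setT; exact: openT. Qed.

Fact torus_openI U V :
  torus_open U -> torus_open V -> torus_open (U `&` V).
Proof. exact: openI. Qed.

Fact torus_open_bigcup (I : Type) (F : I -> set torus) :
  (forall i, torus_open (F i)) -> torus_open (\bigcup_i F i).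
Proof. by move=> Fo; apply: bigcup_open => i _; exact: Fo. Qed.

HB.instance Definition _ :=
  isOpenTopological.Build torus torus_openT torus_openI torus_open_bigcup.

End Torus.

Section Null.
Context {R : realType} {d : nat}.

Definition box (a b : 'rV[R]_d) : set 'rV[R]_d :=
  [set x | forall i, a 0 i <= x 0 i <= b 0 i].

(* Zero Lebesgue outer measure: for every e > 0 there is a cover by countably
   many (possibly none, which matters when d = 0) boxes of total volume at most
   e. *)
Definition lebesgue_null (N : set 'rV[R]_d) :=
  forall e : R, 0 < e -> exists (K : set nat) (a b : nat -> 'rV[R]_d),
    [/\ forall k i, a k 0 i <= b k 0 i,
        N `<=` \bigcup_(k in K) box (a k) (b k) &
        (\esum_(k in K) (\prod_i (b k 0 i - a k 0 i))%:E <= e%:E)%E].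

(* Lebesgue measure on the torus is the image, under the quotient map, of
   Lebesgue measure on the fundamental domain [0, 1)^d. *)
Definition torus_null (N : set (torus R d)) :=
  lebesgue_null
    [set x : 'rV[R]_d | (forall i, 0 <= x 0 i < 1) /\ N (\pi_(torus R d)%qT x)].

End Null.

Section Extension.
Context {R : realType} {d : nat} {A : finType}.
Implicit Types (Omega : set (biinfinite A)) (f : biinfinite A -> torus R d).
Implicit Types alpha : torus R d.

(* Only the values of [f] on [Omega] matter. *)
Definition extension Omega f alpha :=
  {within Omega, continuous f} /\
  forall u, Omega u -> f (shift u) = f u + alpha.

Definition minimal_translation alpha :=
  forall x : torus R d, dense (range (fun n : int => x + alpha *~ n)).

Definition almost_everywhere_finite_fibers Omega f :=
  torus_null [set x | ~ finite_set (Omega `&` f @^-1` [set x])].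

Definition finite_extension_of_minimal_translation Omega :=
  exists f alpha,
    [/\ extension Omega f alpha, minimal_translation alpha &
        almost_everywhere_finite_fibers Omega f].

End Extension.
Arguments finite_extension_of_minimal_translation R d {A} Omega.

(* Main.v *)
Require Import Defs.
From mathcomp Require Import all_boot all_order all_algebra complex.
From mathcomp Require Import all_classical all_reals all_analysis.
From mathcomp Require Import finmap ring_quotient ring lra zify.

Set Implicit Arguments.
Unset Strict Implicit.
Unset Printing Implicit Defensive.

Import Order.TTheory GRing.Theory Num.Theory.
Import numFieldNormedType.Exports.

Local Open Scope classical_set_scope.
Local Open Scope ring_scope.
Local Open Scope complex_scope.

(** Write l_n(w) for the length of sigma^n(w), M for the incidence matrix, and
    P for the minimal polynomial of beta.

    As beta is Pisot, P has integer coefficients and P = Q (X - beta) with all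
    the roots of Q inside the unit disc; as sigma is pseudo-unimodular and P
    divides the characteristic polynomial of M, the constant coefficient of P
    is a unit.  The row 1.P(M) kills each generalized eigenspace of modulus
    at least 1: by the hypothesis on sums when the eigenvalue is not beta, and
    because beta is a simple eigenvalue otherwise.  So the integer rows
    1.P(M)M^n tend to 0, hence vanish for n large
    ([pisot_matrix_recurrence]): the lengths l_n(w) eventually satisfy the
    linear recurrence of characteristic polynomial P.  It follows that the
    defect of a word, beta l_0(w) - l_1(w), satisfies
    defect(sigma^n(w)) = O(rho^n) for some rho < 1, first for letters
    ([defect_decays]), then uniformly over the factors w of the points of
    Omega ([defect_window]).

    The defect of the letter at 0 is therefore the coboundary of a continuous
    function on Omega, the [transfer] function, namely minus the supremum of
    the defects of the prefixes of the right half of a point.  The usual way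
    to such a function is through the recognizability of sigma; here
    [height_compare] shows directly that the supremum depends, up to
    O(rho^n), only on how the point is cut into words sigma^n(a).  With
    F_i(u) = sum_(j <= i) beta^(i-j) transfer(sigma^j(u)) one gets
    F_i(S u) - F_i(u) = beta^(i+1) - l_(i+1)(u_0), so F modulo Z^d maps S to
    the translation by (beta, ..., beta^d).

    This translation is minimal ([powers_minimal_translation]): in the
    coordinates beta t_j - t_(j+1), the group generated by the translation
    vector and Z^d is the set of all integer vectors (t_0, ..., t_d); it is
    stable under the shift of P-recurrent sequences, which acts as a
    contraction since only the roots of Q remain, so this group contains
    arbitrarily small bases of R^d.

    Finally all the fibres of F modulo Z^d are finite
    ([factor_map_fibre_finite]), in particular almost all of them.
    Write u = S^k sigma^n(u') and v = S^k' sigma^n(v') with u', v' in Omega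
    starting with the same letter, and let s_m be the difference of the
    lengths of the images under sigma^m of the prefixes of lengths k and k'.
    If u and v have the same image, then beta s_m - s_(m+1) depends on u', v'
    only, and s can be extended n steps backwards as an integer sequence, P
    having a unit as constant coefficient.  The terms reached in this way are
    bounded independently of n ([backward_lengths]) and determine s.  Hence
    the number of pairs (first letter of u', k) that occur in a fibre is
    bounded independently of n; as sigma is proper, points that share such a
    pair agree on a window around 0 which grows with n, and so the same
    number bounds the size of the fibre. *)

Local Notation shift := Defs.shift.

(** * Linear recurrences *)

Section Recurrence.
Context {K : comNzRingType}.
Implicit Types (p q : {poly K}) (s t : nat -> K).

(** The polynomial p in the shift operator, applied to the sequence s: s
    satisfies the recurrence of characteristic polynomial p when this
    vanishes. *)
Definition recur p s n := \sum_(j < size p) p`_j * s (n + j)%N.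

Lemma recur_wide m p s n : (size p <= m)%N ->
  recur p s n = \sum_(j < m) p`_j * s (n + j)%N.
Proof.
move=> pm; rewrite /recur (big_ord_widen _ (fun j => p`_j * s (n + j)%N) pm).
rewrite big_mkcond; apply: eq_bigr => j _; case: ltnP => // jp.
by rewrite nth_default ?mul0r.
Qed.

Lemma recurD p q s n : recur (p + q) s n = recur p s n + recur q s n.
Proof.
pose m := maxn (size p) (size q).
rewrite !(@recur_wide m) ?leq_maxl ?leq_maxr ?size_polyD // -big_split /=.
by apply: eq_bigr => j _; rewrite coefD mulrDl.
Qed.

Lemma recurZ c p s n : recur (c *: p) s n = c * recur p s n.
Proof.
rewrite !(@recur_wide (size p)) ?size_scale_leq // mulr_sumr.
by apply: eq_bigr => j _; rewrite coefZ mulrA.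
Qed.

Lemma recur0 s n : recur 0 s n = 0.
Proof. by rewrite /recur size_poly0 big_ord0. Qed.

Lemma recur_sum m (f : 'I_m -> {poly K}) s n :
  recur (\sum_i f i) s n = \sum_i recur (f i) s n.
Proof.
apply: (big_morph (fun p => recur p s n)) => [p q|]; first exact: recurD.
exact: recur0.
Qed.

Lemma recurXn k s n : recur 'X^k s n = s (n + k)%N.
Proof.
rewrite (@recur_wide k.+1) ?size_polyXn // (bigD1 ord_max) //= coefXn eqxx mul1r.
rewrite big1 ?addr0 // => j jk; rewrite coefXn.
by move: jk; rewrite -val_eqE /= => /negPf->; rewrite mul0r.
Qed.

Lemma recur_eq p s t n : (forall j, (n <= j)%N -> s j = t j) ->
  recur p s n = recur p t n.
Proof. by move=> st; apply: eq_bigr => j _; rewrite st ?leq_addr. Qed.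

Lemma recurM p q s n : recur (p * q) s n = recur p (recur q s) n.
Proof.
have -> : p * q = \sum_(i < size p) \sum_(j < size q) (p`_i * q`_j) *: 'X^(i + j).
  rewrite -{1}[p]coefK -{1}[q]coefK !poly_def mulr_suml; apply: eq_bigr => i _.
  rewrite mulr_sumr; apply: eq_bigr => j _.
  by rewrite -scalerAl -scalerAr scalerA exprD.
rewrite recur_sum; apply: eq_bigr => i _.
rewrite recur_sum {2}/recur mulr_sumr; apply: eq_bigr => j _.
by rewrite recurZ recurXn addnA mulrA.
Qed.

Lemma recur_XsubC c s n : recur ('X - c%:P) s n = s n.+1 - c * s n.
Proof.
rewrite -polyCN -alg_polyC recurD -['X]expr1 recurXn addn1; congr (_ + _).
by rewrite recurZ -(expr0 'X) recurXn addn0 mulNr.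
Qed.

Lemma recur_shift p s m n : recur p (fun i => s (m + i)%N) n = recur p s (m + n)%N.
Proof. by apply: eq_bigr => j _; rewrite addnA. Qed.

Lemma recur_sub p s t n :
  recur p (fun i => s i - t i) n = recur p s n - recur p t n.
Proof. by rewrite -sumrB; apply: eq_bigr => j _; rewrite mulrBr. Qed.

Lemma recur_add p s t n :
  recur p (fun i => s i + t i) n = recur p s n + recur p t n.
Proof. by rewrite -big_split; apply: eq_bigr => j _ /=; rewrite mulrDr. Qed.

(** The solution is n |-> L(X^n mod p), where L is the linear form X^j |-> g
    j. *)
Lemma recur_extend p (g : nat -> K) : p \is monic ->
  exists2 s, forall j, (j < (size p).-1)%N -> s j = g j & forall n, recur p s n = 0.
Proof.
move=> pm; pose L (q : {poly K}) := recur q g 0.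
exists (fun n => L (Pdiv.CommonRing.rmodp 'X^n p)) => [j jp|n].
  rewrite Pdiv.CommonRing.rmodp_small ?size_polyXn; last by case: (size p) jp.
  by rewrite /L recurXn.
have -> : recur p (fun n => L (Pdiv.CommonRing.rmodp 'X^n p)) n =
   L (Pdiv.CommonRing.rmodp ('X^n * p) p).
  rewrite -[in 'X^n * p](coefK p) poly_def mulr_sumr.
  rewrite (big_morph _ (fun a b => Pdiv.RingMonic.rmodpD pm a b)
    (Pdiv.CommonRing.rmod0p p)).
  rewrite /L recur_sum; apply: eq_bigr => j _.
  by rewrite -scalerAr -exprD Pdiv.RingMonic.rmodpZ // recurZ.
by rewrite Pdiv.RingMonic.rmodp_mull // /L recur0.
Qed.

Lemma recur_unique p s n : p \is monic ->
  (forall i, recur p s i = 0) -> (forall j, (j < (size p).-1)%N -> s j = 0) -> s n = 0.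
Proof.
move=> pm ps s0; elim/ltn_ind: n => n IH.
case: (ltnP n (size p).-1) => [/s0//|np].
have sp : size p = (size p).-1.+1 by rewrite prednK // size_poly_gt0 monic_neq0.
have := ps (n - (size p).-1)%N; rewrite (@recur_wide (size p).-1.+1);
  last by rewrite -sp.
rewrite big_ord_recr /= -lead_coefE (monicP pm) mul1r subnK // big1 ?add0r // => j _.
rewrite IH ?mulr0 //; case: j => j /=; move: np; move: (size p).-1 => k; lia.
Qed.

End Recurrence.

Section RecurrenceUnit.
Context {K : comUnitRingType}.
Implicit Types (p q : {poly K}) (s t : nat -> K).

Lemma recur_split p s n : p != 0 ->
  recur p s n = p`_0 * s n + \sum_(j < (size p).-1) p`_j.+1 * s (n + j.+1)%N.
Proof.
move=> p0; rewrite (@recur_wide _ (size p).-1.+1) ?leqSpred //.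
by rewrite big_ord_recl /= addn0.
Qed.

Lemma recur_extend_back p s m : p`_0 \is a GRing.unit -> (forall n, recur p s n = 0) ->
  exists2 t, forall i, t (m + i)%N = s i & forall n, recur p t n = 0.
Proof.
move=> pu ps; have p0 : p != 0 by apply: contraTneq pu => ->; rewrite coef0 unitr0.
elim: m => [|m [t ts pt]]; first by exists s.
pose t0 := - (p`_0)^-1 * \sum_(j < (size p).-1) p`_j.+1 * t j.
exists (fun i => if i is i'.+1 then t i' else t0) => [i|[|n]]; first exact: ts.
  by rewrite recur_split //= /t0 mulrA mulrN mulrV // mulN1r addNr.
by rewrite -(pt n) /recur; apply: eq_bigr => j _; rewrite addSn.
Qed.

Lemma recur_unique_back p s m : p`_0 \is a GRing.unit -> (forall n, recur p s n = 0) ->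
  (forall i, (m <= i)%N -> s i = 0) -> forall i, s i = 0.
Proof.
move=> pu ps; have p0 : p != 0 by apply: contraTneq pu => ->; rewrite coef0 unitr0.
elim: m => [|m IH] sm i; first exact: sm.
apply: (IH) => {}i; rewrite leq_eqVlt => /predU1P[<-|/sm//].
have := ps m; rewrite recur_split // big1 ?addr0 => [|j _]; last first.
  by rewrite sm ?mulr0 // addnS ltnS leq_addr.
by move/(congr1 ( *%R (p`_0)^-1)); rewrite mulKr // mulr0.
Qed.

End RecurrenceUnit.

Lemma recur_map (K L : comNzRingType) (f : {rmorphism K -> L}) (p : {poly K}) s n :
  recur (map_poly f p) (f \o s) n = f (recur p s n).
Proof.
rewrite (@recur_wide _ (size p)) ?size_poly // rmorph_sum /=.
by apply: eq_bigr => j _; rewrite coef_map rmorphM.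
Qed.

(** Peeling off one root z at a time: s (n+1) - z s n satisfies the recurrence
    of the other roots, and the geometric estimate survives since |z| < rho.
    The constant is uniform in s and linear in the size k of the initial
    values. *)
Lemma recur_decay (K : numFieldType) (rho : K) (rs : seq K) :
  (forall z, z \in rs -> `|z| < rho) -> 0 < rho ->
  exists2 C, 0 <= C & forall (s : nat -> K) k, 0 <= k ->
    (forall n, recur (\prod_(z <- rs) ('X - z%:P)) s n = 0) ->
    (forall j, (j < size rs)%N -> `|s j| <= k) ->
    forall n, `|s n| <= k * C * rho ^+ n.
Proof.
move=> + rho0; elim: rs => [|z rs IH] zrho.
  exists 0 => // s k k0 + _ n => /(_ n).
  by rewrite big_nil -(expr0 'X) recurXn addn0 => ->; rewrite normr0 mulr0 mul0r.
have [|C C0 HC] := IH; first by move=> y yrs; rewrite zrho // inE yrs orbT.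
have zr : 0 < rho - `|z| by rewrite subr_gt0 zrho // mem_head.
pose D := 1 + (1 + `|z|) * C / (rho - `|z|).
have D1 : 0 <= (1 + `|z|) * C / (rho - `|z|).
  by rewrite divr_ge0 ?(ltW zr) // mulr_ge0 // addr_ge0.
exists D => [|s k k0 ps sk]; first by rewrite addr_ge0.
have st n : `|s n.+1 - z * s n| <= k * (1 + `|z|) * C * rho ^+ n.
  apply: (HC (fun n => s n.+1 - z * s n)) => [|{}n|j jr].
  - by rewrite mulr_ge0 ?addr_ge0.
  - rewrite -(ps n) big_cons mulrC recurM; apply: recur_eq => j _.
    by rewrite recur_XsubC.
  - rewrite (le_trans (ler_normB _ _)) // normrM mulrDr mulr1 lerD ?sk // mulrC.
    by rewrite ler_wpM2r // sk // ltnW.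
elim=> [|n IHn].
  rewrite expr0 mulr1 (le_trans (sk _ _)) // /D mulrDr mulr1 lerDl.
  by rewrite mulr_ge0.
have -> : s n.+1 = (s n.+1 - z * s n) + z * s n by rewrite subrK.
rewrite (le_trans (ler_normD _ _)) // normrM.
apply: (le_trans (lerD (st n) (ler_wpM2l (normr_ge0 z) IHn))).
have -> : k * (1 + `|z|) * C * rho ^+ n + `|z| * (k * D * rho ^+ n) =
    k * rho ^+ n * ((1 + `|z|) * C + `|z| * D) by ring.
have -> : k * D * rho ^+ n.+1 = k * rho ^+ n * (D * rho) by rewrite exprSr; ring.
rewrite ler_wpM2l ?mulr_ge0 ?exprn_ge0 ?(ltW rho0) //.
rewrite -lerBrDr (mulrC `|z|) -mulrBr [D * _]mulrDl mul1r divfK ?gt_eqF //.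
by rewrite lerDr ltW.
Qed.

(** * Decay of contracting recurrences *)

Section Decay.
Context {R : realType}.
Local Notation ZtoR := (map_poly (intr : int -> R)).
Local Notation ZtoC := (map_poly (intr : int -> R[i])).
Local Notation RtoC := (map_poly (real_complex R)).

Lemma normc_real (x : R) : `|x%:C| = `|x|%:C.
Proof. by rewrite normc_def /= expr0n addr0 sqrtr_sqr. Qed.

Lemma common_radius (rs : seq R[i]) : (forall z, z \in rs -> `|z| < 1) ->
  exists2 rho : R, 0 < rho < 1 & forall z, z \in rs -> `|z| < rho%:C.
Proof.
elim: rs => [_|z rs IH z1]; first by exists (2^-1) => //; lra.
have [|rho rho01 rsrho] := IH; first by move=> y ys; apply: z1; rewrite inE ys orbT.
have := z1 z (mem_head _ _); rewrite normc_def; set c := Num.sqrt _ => c1.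
have {}c1 : c < 1 by rewrite -ltcR.
exists (Num.max rho ((1 + c) / 2)) => [|y].
  rewrite lt_max gt_max; apply/andP; split; first by apply/orP; left; lra.
  by apply/andP; split; lra.
rewrite inE => /predU1P[->|/rsrho yr];
  last by rewrite (lt_le_trans yr) // lecR le_max lexx.
by rewrite normc_def -/c ltcR lt_max; apply/orP; right; lra.
Qed.

Lemma expr_lt_eventually (rho e : R) : 0 < rho < 1 -> 0 < e ->
  exists N, forall n, (N <= n)%N -> rho ^+ n < e.
Proof.
move=> /andP[r0 r1] e0; have r1' : `|rho| < 1 by rewrite gtr0_norm.
have /cvgr0_norm_lt /(_ e e0) [N _ HN] := cvg_expr r1'.
by exists N => n /HN; rewrite /= normrX gtr0_norm.
Qed.

Lemma geom_le_eq0 (rho c x : R) : 0 < rho < 1 ->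
  (forall n, `|x| <= c * rho ^+ n) -> x = 0.
Proof.
move=> rho01 xc; have c0 : 0 <= c by have := xc 0%N; rewrite expr0 mulr1;
  apply: le_trans.
apply/eqP; apply: contraT; rewrite -normr_gt0 => x0.
have c1 : 0 < c + 1 by lra.
have [N /(_ N (leqnn _))] := expr_lt_eventually rho01 (divr_gt0 x0 c1).
rewrite ltr_pdivlMr // => xN; have := xc N.
have : 0 < rho ^+ N by rewrite exprn_gt0 //; case/andP: rho01.
by move: xN; move: (rho ^+ N) `|x| => y z; nra.
Qed.

Lemma recur_decayC (rs : seq R[i]) : (forall z, z \in rs -> `|z| < 1) ->
  exists rho C : R, [/\ 0 < rho < 1, 0 <= C &
    forall (s : nat -> R[i]) (k : R), 0 <= k ->
    (forall n, recur (\prod_(z <- rs) ('X - z%:P)) s n = 0) ->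
    (forall j, (j < size rs)%N -> `|s j| <= k%:C) ->
    forall n, `|s n| <= (k * C * rho ^+ n)%:C].
Proof.
move=> /common_radius[rho rho01 /recur_decay[]]; first by rewrite ltcR;
  case/andP: rho01.
move=> C C0 H; exists rho, (complex.Re C).
have CE : C = (complex.Re C)%:C by case: C C0 {H} => a b /=;
  rewrite lecE /= => /andP[/eqP->].
split=> //; first by rewrite -lecR -CE.
move=> s k k0 /H{}H sk n; rewrite !rmorphM rmorphXn /= -CE.
by apply: H => //; rewrite lecR.
Qed.

Lemma recur_decayR (Q : {poly R}) (rs : seq R[i]) :
  RtoC Q = \prod_(z <- rs) ('X - z%:P) -> (forall z, z \in rs -> `|z| < 1) ->
  exists rho C : R, [/\ 0 < rho < 1, 0 <= C & forall (s : nat -> R) (k : R), 0 <= k ->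
    (forall n, recur Q s n = 0) ->
    (forall j, (j < size rs)%N -> `|s j| <= k) ->
    forall n, `|s n| <= k * C * rho ^+ n].
Proof.
move=> QE /recur_decayC[rho [C [rho01 C0 H]]]; exists rho, C; split=> // s k k0 Qs sk n.
rewrite -lecR -normc_real; apply: (H (real_complex R \o s)) => // {}n.
  by rewrite -QE recur_map Qs rmorph0.
by move=> nr; rewrite normc_real lecR sk.
Qed.

(** The terms are integers and tend to 0. *)
Lemma int_recur_eventually0 (rs : seq R[i]) (s : nat -> int) :
  (forall z, z \in rs -> `|z| < 1) ->
  (forall n, recur (\prod_(z <- rs) ('X - z%:P)) (fun i => (s i)%:~R) n = 0) ->
  exists N, forall n, (N <= n)%N -> s n = 0.
Proof.
move=> /recur_decayC[rho [C [rho01 C0 H]]] rs0.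
pose k : R := \sum_(j < size rs) `|s j|%:~R.
have k0 : 0 <= k by apply: sumr_ge0 => j _; rewrite ler0z.
have sE j : `|(s j)%:~R : R[i]| = (`|s j|%:~R)%:C by rewrite -intr_norm rmorph_int.
have {}H := H _ k k0 rs0.
have [||N HN] := @expr_lt_eventually rho (k * C + 1)^-1 => //.
  by rewrite invr_gt0 ltr_wpDl // mulr_ge0.
exists N => n /HN rn; have : `|(s n)%:~R : R[i]| < 1.
  apply: (le_lt_trans (H _ n)) => [j jr|].
    rewrite sE lecR /k (bigD1 (Ordinal jr)) //= lerDl.
    by apply: sumr_ge0 => i _; rewrite ler0z.
  rewrite ltcR; have kC : 0 <= k * C by rewrite mulr_ge0.
  have : rho ^+ n * (k * C + 1) < 1 by rewrite -ltr_pdivlMr ?div1r // ltr_wpDl.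
  have : 0 < rho ^+ n by rewrite exprn_gt0 //; case/andP: rho01.
  by move: (rho ^+ n) => x ? ?; nra.
by rewrite sE ltcR ltrz1; lia.
Qed.

End Decay.

(** * Annihilation of generalized eigenspaces *)

Lemma recur_mx (K : comNzRingType) n (M : 'M[K]_n.+1) (w : 'rV[K]_n.+1) p j m :
  recur p (fun i => (w *m M ^+ i) 0 j) m = (w *m M ^+ m *m horner_mx M p) 0 j.
Proof.
rewrite -[in RHS](coefK p) poly_def rmorph_sum /= mulmx_sumr summxE.
apply: eq_bigr => i _.
by rewrite linearZ /= rmorphXn /= horner_mx_X -scalemxAr [in RHS]mxE exprD -mulmxE
  mulmxA.
Qed.

Lemma horner_mx_comm (K : comNzRingType) n (M : 'M[K]_n.+1) p q :
  horner_mx M p *m horner_mx M q = horner_mx M q *m horner_mx M p.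
Proof. by have := comm_horner_mx2 M p q. Qed.

Lemma horner_mx_expC (K : comNzRingType) n (M : 'M[K]_n.+1) p m :
  M ^+ m *m horner_mx M p = horner_mx M p *m M ^+ m.
Proof. by have := horner_mx_comm M 'X^m p; rewrite rmorphXn /= horner_mx_X. Qed.

(** Bezout: ker (p q)(M) is the sum of ker p(M) and ker q(M). *)
Lemma annihilates_ker_coprime (F : fieldType) n (M : 'M[F]_n.+1) (w : 'rV[F]_n.+1) p q :
  coprimep p q ->
  (forall v : 'cV_n.+1, horner_mx M p *m v = 0 -> w *m v = 0) ->
  (forall v : 'cV_n.+1, horner_mx M q *m v = 0 -> w *m v = 0) ->
  forall v : 'cV_n.+1, horner_mx M (p * q) *m v = 0 -> w *m v = 0.
Proof.
move=> /Bezout_eq1_coprimepP[[a b] /= ab1] wp wq v pqv.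
have -> : v = horner_mx M (a * p) *m v + horner_mx M (b * q) *m v.
  by rewrite -mulmxDl -rmorphD ab1 rmorph1 mul1mx.
have zero c r1 r2 : horner_mx M (r1 * r2) *m v = 0 ->
    horner_mx M r2 *m (horner_mx M (c * r1) *m v) = 0.
  move=> rv; rewrite mulmxA -[_ *m horner_mx _ _]rmorphM /= mulrCA [r2 * _]mulrC.
  by rewrite rmorphM /= -mulmxA rv mulmx0.
rewrite mulmxDr wq ?zero // wp ?zero ?addr0 //.
by rewrite mulrC.
Qed.

Lemma annihilates_ker_prod (F : fieldType) n (M : 'M[F]_n.+1) (w : 'rV[F]_n.+1)
    (k : F -> nat) (s : seq F) :
  uniq s ->
  (forall z, z \in s -> forall v : 'cV_n.+1,
     horner_mx M (('X - z%:P) ^+ k z) *m v = 0 -> w *m v = 0) ->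
  forall v : 'cV_n.+1,
    horner_mx M (\prod_(z <- s) ('X - z%:P) ^+ k z) *m v = 0 -> w *m v = 0.
Proof.
elim: s => [|z s IH] /= => [_ _ v|/andP[zs us] wz].
  by rewrite big_nil rmorph1 mul1mx => ->; rewrite mulmx0.
rewrite big_cons; apply: annihilates_ker_coprime.
- rewrite coprimep_expl // big_seq_cond.
  apply: (big_ind (fun q : {poly F} => coprimep ('X - z%:P) q)) => [|p q|y].
  + exact: coprimep1.
  + by rewrite coprimepMr => ? ?; apply/andP.
  rewrite andbT => ys; rewrite coprimep_expr // coprimep_XsubC root_XsubC.
  by apply: contraNneq zs => <-.
- by apply: wz; rewrite mem_head.
- by apply: IH => // y ys; apply: wz; rewrite inE ys orbT.
Qed.

(** * The eventual recurrence *)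

Section Integral.
Context {R : realType}.
Implicit Types (beta : R).
Local Notation ZtoR := (map_poly (intr : int -> R)).
Local Notation ZtoC := (map_poly (intr : int -> R[i])).
Local Notation ZtoQ := (map_poly (intr : int -> rat)).
Local Notation QtoR := (map_poly (ratr : rat -> R)).
Local Notation QtoC := (map_poly (ratr : rat -> R[i])).
Local Notation RtoC := (map_poly (real_complex R)).

Lemma ZtoRtoC P : RtoC (ZtoR P) = ZtoC P.
Proof. by rewrite -map_poly_comp; apply: eq_map_poly => x /=; rewrite rmorph_int. Qed.

Lemma ZtoQtoR P : QtoR (ZtoQ P) = ZtoR P.
Proof. by rewrite -map_poly_comp; apply: eq_map_poly => x /=; rewrite ratr_int. Qed.

Lemma ZtoQtoC P : QtoC (ZtoQ P) = ZtoC P.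
Proof. by rewrite -map_poly_comp; apply: eq_map_poly => x /=; rewrite ratr_int. Qed.

(** Gauss lemma. *)
Lemma monic_rat_factor_int (chi : {poly int}) (p : {poly rat}) :
  chi \is monic -> p \is monic -> p %| ZtoQ chi ->
  exists P S, [/\ P \is monic, chi = P * S & ZtoQ P = p].
Proof.
move=> mchi mp /dvdpP_rat_int[P [a a0 pE] [S chiE]].
have lPS : lead_coef P * lead_coef S = 1 by rewrite -lead_coefM -chiE (monicP mchi).
have lu : lead_coef P * lead_coef P = 1.
  have /unitrP : lead_coef P \is a GRing.unit.
    by apply/unitrP; exists (lead_coef S); rewrite [X in X = 1]mulrC.
  move=> _; have := congr1 (fun x : int => `|x|%N) lPS; rewrite abszM /= => /eqP.
  rewrite muln_eq1 => /andP[/eqP lP _].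
  by case: (intP (lead_coef P)) lP => // k; rewrite ?abszN /= => -[->].
exists (lead_coef P *: P), (lead_coef P *: S); split.
- by rewrite monicE lead_coefZ lu.
- by rewrite -scalerAl -scalerAr scalerA lu scale1r.
- rewrite pE map_polyZ /=; congr (_ *: _).
  have := congr1 lead_coef pE; rewrite (monicP mp) lead_coefZ.
  rewrite lead_coef_map_inj //; last exact: intr_inj.
  move/(congr1 (fun x => x * (lead_coef P)%:~R)); rewrite mul1r -mulrA -intrM lu mulr1.
  by [].
Qed.

(** Otherwise X divides p, and p / X is a smaller polynomial that vanishes at
    beta. *)
Lemma minimal_polynomial_coef0 (p : {poly rat}) beta :
  beta != 0 -> minimal_polynomial p beta -> p`_0 != 0.
Proof.
move=> b0 [mp rp pmin]; apply: contraTneq (isT : true) => p0.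
have /factor_theorem[q pE] : root p 0 by rewrite /root horner_coef0 p0.
have qn0 : q != 0 by apply: contraTneq mp => q0;
  rewrite pE q0 mul0r monicE lead_coef0 eq_sym oner_eq0.
have : root (QtoR q) beta.
  move: rp; rewrite pE rmorphM rootM /= map_polyXsubC rmorph0 root_XsubC.
  by rewrite (negPf b0) orbF.
move/pmin/dvdp_leq => /(_ qn0); rewrite pE polyC0 subr0 size_mulX //.
by rewrite ltnn.
Qed.

(** The multiplicity of beta in P S being 1, beta is a simple root of P, so
    the other roots of P differ from beta and the Pisot condition applies to
    them. *)
Lemma pisot_conjugates (P S : {poly int}) (p : {poly rat}) beta :
  P \is monic -> S != 0 -> pisot beta -> minimal_polynomial p beta -> ZtoQ P = p ->
  mup beta%:C (ZtoC (P * S)) = 1%N ->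
  exists2 rs, ZtoC P = ('X - (beta%:C)%:P) * \prod_(z <- rs) ('X - z%:P) &
    forall z, z \in rs -> `|z| < 1.
Proof.
move=> mP S0 [b1 _ conj] pmin PE mub.
have mPC : ZtoC P \is monic by rewrite monic_map.
have [r] := closed_field_poly_normal (ZtoC P); rewrite (monicP mPC) scale1r => PCE.
have rootE z : (z \in r) = root (ZtoC P) z by rewrite PCE root_prod_XsubC.
have br : beta%:C \in r.
  rewrite rootE -ZtoRtoC; case: pmin => _ + _; rewrite -PE ZtoQtoR.
  by rewrite /root horner_map => /eqP->; rewrite rmorph0.
have PE' : ZtoC P = ('X - (beta%:C)%:P) * \prod_(z <- rem beta%:C r) ('X - z%:P).
  by rewrite PCE (perm_big _ (perm_to_rem br)) big_cons.
have SC0 : ZtoC S != 0.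
  by rewrite map_poly_eq0_id0 ?lead_coef_eq0 // intr_eq0 lead_coef_eq0.
exists (rem beta%:C r) => // z zr.
apply: conj; first by exists p => //; rewrite -PE ZtoQtoC -rootE (mem_rem zr).
apply: contraTneq zr => ->; rewrite -has_pred1 has_count -leqNgt.
move: mub; rewrite rmorphM mupM ?(monic_neq0 mPC) //= PCE mu_prod_XsubC.
by rewrite (permP (perm_to_rem br)) /= eqxx add1n addSn => -[/eqP];
  rewrite addn_eq0 => /andP[/eqP->].
Qed.

(** With S = X^k S' and S'(0) != 0, the constant coefficient of P S' is, up to
    sign, the product of the non-zero eigenvalues. *)
Lemma factor_coef0_unit n (M : 'M[int]_n) (P S : {poly int}) :
  pseudo_unimodular_mx (complex_mx M : 'M[R[i]]_n) ->
  char_poly M = P * S -> P`_0 != 0 -> P`_0 \is a GRing.unit.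
Proof.
rewrite /pseudo_unimodular_mx /spectrum.
case: closed_field_poly_normal => /= sp spE unim chiE P0.
have chi0 : char_poly M != 0 by rewrite monic_neq0 ?char_poly_monic.
have S0 : S != 0 by apply: contraNneq chi0 => S0; rewrite chiE S0 mulr0.
have [k [S' + SE]] := multiplicity_XsubC S 0; rewrite S0 /= => S'0.
rewrite subr0 in SE.
have SP'0 : (P * S')`_0 != 0.
  by rewrite coef0M mulf_neq0 // -horner_coef0.
move: spE; rewrite (monicP (char_poly_monic _)) scale1r -map_char_poly chiE SE mulrA.
rewrite rmorphM /= map_polyXn => spE.
suff : ((P * S')`_0)%:~R =
    (-1) ^+ size [seq z <- sp | z != 0] * \prod_(z <- sp | z != 0) z :> R[i].
  move=> cE; have : ((P * S')`_0) ^+ 2 = 1.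
    apply: (@intr_inj R[i]); rewrite rmorphXn /= cE exprMn -exprM mulnC exprM sqrrN
      !expr1n mul1r.
    by case: unim => ->; rewrite ?sqrrN expr1n.
  rewrite coef0M exprMn => /(congr1 (fun x => x \is a GRing.unit)).
  by rewrite unitr1 expr2 unitrM unitrM => /andP[/andP[]].
have XC0 : 'X = 'X - (0 : R[i])%:P by rewrite subr0.
have Psplit : \prod_(z <- sp) ('X - z%:P) =
  \prod_(z <- sp | z != 0) ('X - z%:P) * ('X - 0%:P) ^+ count_mem 0 sp.
  rewrite (bigID (fun z => z == 0)) /= mulrC; congr (_ * _).
  rewrite (eq_bigr (fun=> 'X - 0%:P)) => [|z /eqP-> //].
  by rewrite big_const_seq iter_mulr_1.
have nz : ~~ root (ZtoC (P * S')) 0.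
  by rewrite /root horner_coef0 coef_map intr_eq0.
have nz' : ~~ root (\prod_(z <- sp | z != 0) ('X - z%:P)) 0.
  rewrite -big_filter root_prod_XsubC mem_filter eqxx //.
have kE : k = count_mem 0 sp.
  rewrite -(@mu_prod_XsubC _ 0) -spE mupMr // XC0 mup_XsubCX eqxx //.
move: spE; rewrite Psplit -kE -XC0 => /(mulIf (expf_neq0 _ (negbT (polyX_eq0 _)))).
move/(congr1 (horner^~ 0)); rewrite horner_coef0 coef_map /= => ->.
rewrite horner_prod -big_filter -[in RHS]big_filter.
elim: [seq _ <- _ | _] => [|z l IH]; first by rewrite !big_nil mulr1.
rewrite !big_cons IH hornerXsubC sub0r /= exprS; ring.
Qed.

(** Factor the characteristic polynomial as F G, where F collects the
    eigenvalues of modulus at least 1. The row w = 1.P(M) kills ker F(M),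
    which contains the image of G(M) by Cayley-Hamilton; so w G(M) = 0, the
    entries of w M^m satisfy the contracting recurrence G, and they are
    integers. *)
Lemma eventual_recurrence n (M : 'M[int]_n.+1) (P : {poly int}) (beta : R)
    (Q : {poly R[i]}) :
  let MC : 'M[R[i]]_n.+1 := complex_mx M in
  ZtoC P = Q * ('X - (beta%:C)%:P) ->
  mup beta%:C (char_poly MC) = 1%N ->
  (forall z : R[i], eigenvalue MC z -> 1 <= `|z| -> z != beta%:C ->
     forall v : 'cV[R[i]]_n.+1, generalized_eigenvector MC z v ->
       \sum_a v a 0 = 0) ->
  exists N, forall m, (N <= m)%N ->
    const_mx 1 *m M ^+ m *m horner_mx M P = 0 :> 'rV_n.+1.
Proof.
move=> MC PE mub sum0.
have [sp spE] := closed_field_poly_normal (char_poly MC).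
rewrite (monicP (char_poly_monic _)) scale1r in spE.
pose w : 'rV[R[i]]_n.+1 := const_mx 1 *m horner_mx MC (ZtoC P).
pose big := fun z : R[i] => 1 <= `|z|.
pose G := \prod_(z <- [seq z <- sp | ~~ big z]) ('X - z%:P).
pose F := \prod_(z <- [seq z <- sp | big z]) ('X - z%:P).
have FG : char_poly MC = F * G by rewrite /F /G !big_filter spE (bigID big).
have wF (v : 'cV_n.+1) : horner_mx MC F *m v = 0 -> w *m v = 0.
  rewrite /F -prodr_undup_exp_count; apply: annihilates_ker_prod => [|z];
    first exact: undup_uniq.
  rewrite mem_undup mem_filter => /andP[bz zsp] {}v.
  rewrite count_filter (@eq_count _ _ (pred1 z)); last first.
    by move=> y /=; case: eqVneq => // ->; rewrite bz.
  rewrite -mu_prod_XsubC -spE => zv; rewrite /w -mulmxA.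
  have [zb|zb] := eqVneq z beta%:C.
    rewrite PE rmorphM /= -mulmxA; move: zv; rewrite zb mub expr1 => ->.
    by rewrite !mulmx0.
  have [->|v0] := eqVneq (horner_mx MC (ZtoC P) *m v) 0; first by rewrite mulmx0.
  apply/matrixP => i j; rewrite !ord1 !mxE; under eq_bigr do rewrite mxE mul1r.
  apply: (sum0 z) => //.
    by rewrite eigenvalue_root_char spE root_prod_XsubC.
  split=> //; rewrite -[MC - _](_ : horner_mx MC ('X - z%:P) = _); last first.
    by rewrite rmorphB /= horner_mx_X horner_mx_C.
  by rewrite -rmorphXn /= mulmxA horner_mx_comm -mulmxA zv mulmx0.
have wG : w *m horner_mx MC G = 0.
  have ann (v : 'cV_n.+1) : w *m horner_mx MC G *m v = 0.
    rewrite -mulmxA; apply: wF; rewrite mulmxA -[_ *m horner_mx _ _]rmorphM /= -FG.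
    by rewrite Cayley_Hamilton mul0mx.
  apply/matrixP => i j; have /matrixP/(_ i 0) := ann (delta_mx j 0).
  by rewrite -colE !mxE.
pose x : 'rV[int]_n.+1 := const_mx 1 *m horner_mx M P.
have xE : map_mx intr x = w.
  rewrite map_mxM map_const_mx /= map_horner_mx; by [].
have /(_ _)/cid-/all_sig[N HN] : forall j, exists N, forall m, (N <= m)%N ->
  (x *m M ^+ m) 0 j = 0.
  move=> j; apply: (@int_recur_eventually0 R [seq z <- sp | ~~ big z]).
    move=> z; rewrite mem_filter => /andP[+ _].
    by rewrite /big -real_ltNge ?normr_real ?real1.
  move=> m; rewrite -/G; transitivity (recur G (fun i => (w *m MC ^+ i) 0 j) m).
    apply: recur_eq => i _; have -> : MC ^+ i = map_mx intr (M ^+ i)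
      by rewrite rmorphXn.
    by rewrite -xE -map_mxM [in RHS]mxE.
  by rewrite recur_mx -mulmxA horner_mx_expC mulmxA wG mul0mx mxE.
exists (\max_j N j) => m Nm; apply/matrixP => i j; rewrite ord1 [RHS]mxE.
rewrite -(HN j m) ?(leq_trans (leq_bigmax _) Nm) //.
by rewrite /x -!mulmxA horner_mx_expC.
Qed.

End Integral.

Section PisotRecurrence.
Context {R : realType}.
Local Notation ZtoR := (map_poly (intr : int -> R)).
Local Notation ZtoC := (map_poly (intr : int -> R[i])).
Local Notation ZtoQ := (map_poly (intr : int -> rat)).
Local Notation RtoC := (map_poly (real_complex R)).

(** P stands for the minimal polynomial of beta and Q for the product of X - z
    over the other conjugates z; the fields are all that is used about beta
    from here on. *)
Record pisot_recurrence (beta : R) (d : nat) (P : {poly int}) (Q : {poly R}) : Prop :=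
  PisotRecurrence {
    pisot_gt1 : 1 < beta;
    pisot_monic : P \is monic;
    pisot_size : size P = d.+2;
    pisot_unit : P`_0 \is a GRing.unit;
    pisot_factor : ZtoR P = Q * ('X - beta%:P);
    pisot_contract : exists2 rs : seq R[i], RtoC Q = \prod_(z <- rs) ('X - z%:P) &
       forall z, z \in rs -> `|z| < 1 }.

Lemma minimal_polynomial_monic (p : {poly rat}) (x : R) :
  minimal_polynomial p x -> p \is monic.
Proof. by case. Qed.

Lemma pisot_matrix_recurrence n (M : 'M[int]_n) (beta : R) d :
  pseudo_unimodular_mx (complex_mx M : 'M[R[i]]_n) ->
  perron_eigenvalue (complex_mx M) beta -> pisot beta -> algebraic_degree beta d.+1 ->
  (forall z : R[i], eigenvalue (complex_mx M) z -> 1 <= `|z| -> z != beta%:C ->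
     forall v : 'cV[R[i]]_n, generalized_eigenvector (complex_mx M) z v ->
       \sum_a v a 0 = 0) ->
  exists P Q, pisot_recurrence beta d P Q /\
    exists N, forall m j, (N <= m)%N ->
      recur P (fun i => ((const_mx 1 : 'rV_n) *m M ^+ i) 0 j) m = 0.
Proof.
case: n M => [|n] M unim [eb mub _] pb [p pmin sp] sum0.
  by move/eigenvalueP: eb => [v _]; rewrite [v]thinmx0 eqxx.
have b1 : 1 < beta by case: pb.
have mM : char_poly M \is monic by exact: char_poly_monic.
have chiC : ZtoC (char_poly M) = char_poly (complex_mx M) by rewrite map_char_poly.
have [|P [S [mP chiE PE]]] := monic_rat_factor_int mM (minimal_polynomial_monic pmin).
  case: pmin => _ _; apply; rewrite ZtoQtoR.
  by move: eb; rewrite eigenvalue_root_char -chiC -ZtoRtoC fmorph_root.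
have S0 : S != 0 by apply: contraTneq mM => S0;
  rewrite chiE S0 mulr0 monicE lead_coef0 eq_sym oner_eq0.
have [|rs PC rs1] := pisot_conjugates mP S0 pb pmin PE; first by rewrite -chiE chiC.
have P0 : P`_0 != 0.
  have : p`_0 != 0.
    by apply: minimal_polynomial_coef0 pmin; rewrite gt_eqF // (lt_trans ltr01).
  by rewrite -PE coef_map intr_eq0.
have /factor_theorem[Q QE] : root (ZtoR P) beta.
  by case: pmin => _ + _; rewrite -PE ZtoQtoR.
exists P, Q; split.
  split=> //.
  - by rewrite -sp -PE size_map_inj_poly //; exact: intr_inj.
  - exact: factor_coef0_unit unim chiE P0.
  - exists rs => //; apply: (@mulIf _ ('X - (beta%:C)%:P));
    first by rewrite polyXsubC_eq0.
    by rewrite mulrC -[RHS]mulrC -PC -ZtoRtoC QE rmorphM /= map_polyXsubC mulrC.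
rewrite mulrC in PC.
have [N HN] := eventual_recurrence PC mub sum0.
by exists N => m j Nm; rewrite recur_mx HN // mxE.
Qed.

End PisotRecurrence.

(** * Lengths of iterated images of words *)

Section Words.
Context {A : finType} (s : substitution A).
Implicit Types (w : seq A) (n : nat).

Definition subst_word w := flatten [seq s a | a <- w].
Definition iterword n w := iter n subst_word w.
Definition iterlen n w := size (iterword n w).

Lemma subst_word_cat w1 w2 : subst_word (w1 ++ w2) = subst_word w1 ++ subst_word w2.
Proof. by rewrite /subst_word map_cat flatten_cat. Qed.

Lemma iterword_cat n w1 w2 : iterword n (w1 ++ w2) = iterword n w1 ++ iterword n w2.
Proof. by elim: n => //= n ->; rewrite subst_word_cat. Qed.

Lemma iterwordD m n w : iterword (m + n) w = iterword m (iterword n w).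
Proof. exact: iterD. Qed.

Lemma iterwordSr n w : iterword n.+1 w = iterword n (subst_word w).
Proof. exact: iterSr. Qed.

Lemma iterlen_cat n w1 w2 : iterlen n (w1 ++ w2) = (iterlen n w1 + iterlen n w2)%N.
Proof. by rewrite /iterlen iterword_cat size_cat. Qed.

Lemma iterlenD m n w : iterlen (m + n) w = iterlen m (iterword n w).
Proof. by rewrite /iterlen iterwordD. Qed.

Lemma iterword_nil n : iterword n [::] = [::].
Proof. by elim: n => //= n ->. Qed.

Lemma iterlen_nil n : iterlen n [::] = 0%N.
Proof. by rewrite /iterlen iterword_nil. Qed.

Lemma subst_word_size_ge w : (size w <= size (subst_word w))%N.
Proof.
rewrite /subst_word; elim: w => //= a w IH; rewrite size_cat -add1n leq_add //.
exact: subst_nonerasing.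
Qed.

Lemma iterlen_ge w n : (size w <= iterlen n w)%N.
Proof. by elim: n => [|n IH] //; apply: (leq_trans IH); exact: subst_word_size_ge. Qed.

Lemma iterlen1_gt0 n a : (0 < iterlen n [:: a])%N.
Proof. exact: (iterlen_ge [:: a] n). Qed.

Lemma iterlen_cons n a w : iterlen n (a :: w) = (iterlen n [:: a] + iterlen n w)%N.
Proof. by rewrite -cat1s iterlen_cat. Qed.

Lemma iterlen_sum n w : iterlen n w = (\sum_(a <- w) iterlen n [:: a])%N.
Proof. by elim: w => [|a w IH];
  rewrite ?iterlen_nil ?big_nil // iterlen_cons IH big_cons. Qed.

Lemma count_subst_word b w : count_mem b (subst_word w) =
  (\sum_(a : A) count_mem b (s a) * count_mem a w)%N.
Proof.
elim: w => [|a w IH]; first by rewrite big1 // => a _; rewrite muln0.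
rewrite -[subst_word _]/(s a ++ subst_word w) count_cat IH (bigD1 a) //= [in
  RHS](bigD1 a) //=.
rewrite eqxx mulnDr muln1 addnA; congr (_ + _)%N.
apply: eq_bigr => c /negPf ca; by rewrite [a == c]eq_sym ca.
Qed.

(** The abelianization of a word. *)
Definition occurrences w : 'cV[int]_#|A| := \col_b (count_mem (enum_val b) w)%:Z.

Lemma occurrences_iterword n w :
  occurrences (iterword n w) = incidence_matrix s ^+ n *m occurrences w.
Proof.
have subst_wordE v : occurrences (subst_word v) = incidence_matrix s *m occurrences v.
  apply/matrixP => b j; rewrite !mxE count_subst_word.
  rewrite (big_morph Posz PoszD (erefl _)) (reindex (@enum_val A A)) /=; last first.
    by apply: onW_bij; exact: enum_val_bij.
  by apply: eq_bigr => c _; rewrite !mxE PoszM.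
elim: n => [|n IH]; first by rewrite expr0 mul1mx.
by rewrite [iterword _ _]/(subst_word (iterword n w)) subst_wordE IH mulmxA exprS.
Qed.

Lemma size_occurrences w :
  (size w)%:Z = ((const_mx 1 : 'rV_#|A|) *m occurrences w) 0 0.
Proof.
rewrite mxE; under eq_bigr do rewrite !mxE mul1r.
rewrite -(big_morph Posz PoszD (erefl _)); congr Posz.
transitivity (\sum_(a : A) count_mem a w)%N; last first.
  by rewrite (reindex (@enum_val A A)) //; apply: onW_bij; exact: enum_val_bij.
elim: w => [|c w IH]; first by rewrite big1.
rewrite /= IH big_split /= [X in _ = (X + _)%N](bigD1 c) //= eqxx.
by rewrite [X in (true + X)%N]big1 ?addn0 // => b; rewrite eq_sym => /negPf->.
Qed.

Lemma occurrences1 a : occurrences [:: a] = delta_mx (enum_rank a) 0.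
Proof.
apply/matrixP => b j; rewrite !mxE /= addn0 ord1 eqxx andbT.
by rewrite -(inj_eq enum_val_inj) enum_rankK eq_sym; case: eqP.
Qed.

Lemma iterlen_mx n a : (iterlen n [:: a])%:Z =
  ((const_mx 1 : 'rV_#|A|) *m incidence_matrix s ^+ n) 0 (enum_rank a).
Proof.
by rewrite /iterlen size_occurrences occurrences_iterword occurrences1 mulmxA -colE mxE.
Qed.

Lemma primitive_mem : primitive_subst s ->
  exists n, forall a b, b \in iterword n [:: a].
Proof.
move=> [n _ Mn]; exists n => a b; rewrite -has_pred1 has_count.
rewrite -ltz_nat; have := Mn (enum_rank b) (enum_rank a).
have /matrixP/(_ (enum_rank b) 0) := occurrences_iterword n [:: a].
by rewrite occurrences1 -colE !mxE enum_rankK => ->.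
Qed.

End Words.

Section Defect.
Context {R : realType} {A : finType} (s : substitution A) (beta : R).
Implicit Types w : seq A.

(** The failure of sigma to multiply the length of w by beta; the defects of
    the words sigma^n(w) are contracted because the component of the lengths
    along beta cancels. *)
Definition defect w : R := beta * (size w)%:R - (size (subst_word s w))%:R.

Lemma defect_cat w1 w2 : defect (w1 ++ w2) = defect w1 + defect w2.
Proof. by rewrite /defect subst_word_cat !size_cat !natrD; ring. Qed.

Lemma defect_nil : defect [::] = 0.
Proof. by rewrite /defect /subst_word /= mulr0 subr0. Qed.

Lemma defect_iterwordE w n : defect (iterword s n w) =
  beta * (iterlen s n w)%:Z%:~R - (iterlen s n.+1 w)%:Z%:~R.
Proof. by []. Qed.

End Defect.

Section Lengths.
Context {R : realType} {A : finType} (s : substitution A).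
Context (beta : R) (d : nat) (P : {poly int}) (Q : {poly R}) (N : nat).
Context (pis : pisot_recurrence beta d P Q).
Context (iterlen_rec : forall a n, (N <= n)%N ->
  recur P (fun i => (iterlen s i [:: a])%:Z) n = 0).
Local Notation defect := (defect s beta).
Local Notation ZtoR := (map_poly (intr : int -> R)).

Let b1 : 1 < beta. Proof. by case: pis. Qed.
Let b0 : 0 < beta. Proof. exact: lt_trans ltr01 b1. Qed.

Lemma pisot_cofactor_monic : Q \is monic.
Proof.
have [_ mP _ _ PQ _] := pis; rewrite -(monicMr _ (monicXsubC beta)) -PQ.
by rewrite monic_map.
Qed.

Lemma pisot_cofactor_size : size Q = d.+1.
Proof.
have [_ _ sP _ PQ _] := pis; have : size (ZtoR P) = d.+2.
  by rewrite size_map_inj_poly //; exact: intr_inj.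
rewrite PQ size_Mmonic ?monicXsubC ?monic_neq0 ?pisot_cofactor_monic //.
by rewrite size_XsubC addn2 => -[].
Qed.

Lemma pisot_cofactor_unit : Q`_0 \is a GRing.unit.
Proof.
have [_ _ _ uP PQ _] := pis.
have : (ZtoR P)`_0 \is a GRing.unit by rewrite coef_map rmorph_unit.
by rewrite PQ coef0M unitrM => /andP[].
Qed.

(** P = Q (X - beta). *)
Lemma recur_pisot (t : nat -> int) n :
  recur Q (fun i => beta * (t i)%:~R - (t i.+1)%:~R) n = - (recur P t n)%:~R.
Proof.
have [_ _ _ _ PQ _] := pis.
rewrite -(recur_map (intr : {rmorphism int -> R})) PQ recurM.
rewrite /recur -sumrN; apply: eq_bigr => j _; rewrite -mulrN; congr (_ * _).
by rewrite -/(recur _ _ _) recur_XsubC opprB.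
Qed.

Lemma iterlen_word_rec w n : (N <= n)%N -> recur P (fun i => (iterlen s i w)%:Z) n = 0.
Proof.
move=> Nn; elim: w => [|a w IH].
  by apply: big1 => j _; rewrite iterlen_nil mulr0.
rewrite -(addr0 0) -{1}(iterlen_rec a Nn) -IH -recur_add; apply: recur_eq => j _.
by rewrite iterlen_cons PoszD.
Qed.

Lemma defect_rec w n : (N <= n)%N -> recur Q (fun i => defect (iterword s i w)) n = 0.
Proof.
move=> Nn; under [recur _ _ _]recur_eq => i _ do rewrite defect_iterwordE.
by rewrite (recur_pisot (fun i => (iterlen s i w)%:Z)) iterlen_word_rec // oppr0.
Qed.

Lemma defect_decays : exists C rho : R, [/\ 0 <= C, 0 < rho < 1 &
  forall n a, `|defect (iterword s n [:: a])| <= C * rho ^+ n].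
Proof.
have [rs QE rs1] := pisot_contract pis.
have [rho [C [rho01 C0 H]]] := recur_decayR QE rs1.
have /andP[rho0 rho1] := rho01.
pose k : R := \sum_a \sum_(j < N + size rs) `|defect (iterword s j [:: a])|.
have k0 : 0 <= k by apply: sumr_ge0 => a _; apply: sumr_ge0.
have kP a j : (j < N + size rs)%N -> `|defect (iterword s j [:: a])| <= k.
  move=> jN; rewrite /k (bigD1 a) //= (bigD1 (Ordinal jN)) //= -addrA lerDl.
  by rewrite addr_ge0 ?sumr_ge0 // => b _; exact: sumr_ge0.
have rN : 0 < rho ^+ N by rewrite exprn_gt0.
exists (k * (C + 1) / rho ^+ N), rho; split=> //.
  by rewrite divr_ge0 ?mulr_ge0 ?addr_ge0 // ltW.
move=> n a; rewrite mulrAC ler_pdivlMr //.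
case: (ltnP n N) => nN.
  have rNn : rho ^+ N <= rho ^+ n by rewrite ler_wiXn2l // ?ltW // ltnW.
  rewrite (le_trans (ler_wpM2r (ltW rN) (kP a n _))) ?(leq_trans nN) ?leq_addr //.
  rewrite -mulrA ler_wpM2l // (le_trans rNn) // ler_peMl ?exprn_ge0 ?(ltW rho0) //.
  by rewrite lerDr.
rewrite -(subnKC nN) exprD mulrA [X in _ <= X]mulrAC ler_wpM2r ?(ltW rN) //.
apply: (le_trans (H (fun i => defect (iterword s (N + i) [:: a])) k k0 _ _ (n - N)%N)).
- by move=> i; rewrite (recur_shift Q (fun i =>
  defect (iterword s i [:: a]))) defect_rec ?leq_addr.
- by move=> j jr; rewrite kP // ltn_add2l.
- by rewrite ler_wpM2r ?exprn_ge0 ?(ltW rho0) // ler_wpM2l // lerDl.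
Qed.

Lemma iterlen_growth : exists2 C, 0 <= C & forall n a, (iterlen s n [:: a])%:R <= C *
  beta ^+ n.
Proof.
have [C [rho [C0 rho01 kC]]] := defect_decays.
have {}kC n a : `|defect (iterword s n [:: a])| <= C.
  apply: (le_trans (kC n a)); rewrite ler_piMr // exprn_ile1 //;
    case/andP: rho01 => *; exact: ltW.
have c0 : 0 <= C / (beta - 1) by rewrite divr_ge0 // subr_ge0 ltW.
exists (1 + C / (beta - 1)) => [|n a]; first by rewrite addr_ge0.
suff : (iterlen s n [:: a])%:R + C / (beta - 1) <= (1 +
  C / (beta - 1)) * beta ^+ n by lra.
elim: n => [|n IH]; first by rewrite expr0 mulr1.
have := kC n a; rewrite defect_iterwordE ler_norml => /andP[+ _].
rewrite exprSr mulrA -!pmulrn.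
have cE : C / (beta - 1) * (beta - 1) = C by rewrite divfK // subr_eq0 gt_eqF.
have := ler_wpM2r (ltW b0) IH; rewrite mulrDl.
move: cE; set c := C / _ ; set x := (iterlen s n _)%:R;
  set y := (iterlen _ _ _)%:R => cE h1 h2.
nra.
Qed.

(** As the defect tends to 0 and beta > 1, the lengths eventually increase
    strictly. *)
Lemma iterlen_unbounded (C rho : R) : 0 < rho < 1 -> 0 <= C ->
  (forall n a, `|defect (iterword s n [:: a])| <= C * rho ^+ n) ->
  forall L, exists n0, forall n a, (n0 <= n)%N -> (L <= iterlen s n [:: a])%N.
Proof.
move=> rho01 C0 kC; have C1 : 0 < C + 1 by lra.
have bb : 0 < beta - 1 by rewrite subr_gt0.
have [n1 Hn1] := expr_lt_eventually rho01 (divr_gt0 bb C1).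
have grow n a : (n1 <= n)%N -> (iterlen s n [:: a] < iterlen s n.+1 [:: a])%N.
  move=> /Hn1; rewrite ltr_pdivlMr // => rn; have := kC n a.
  rewrite defect_iterwordE ler_norml => /andP[_]; rewrite -!pmulrn => h.
  rewrite -(ltr_nat R).
  have l1 : 1 <= (iterlen s n [:: a])%:R :> R by rewrite ler1n iterlen1_gt0.
  have r0 : 0 <= rho ^+ n by rewrite exprn_ge0 // ltW //; case/andP: rho01.
  move: l1 h rn; set x := (iterlen s n _)%:R; set y := (iterlen _ _ _)%:R => *.
  nra.
have lb m a : (m <= iterlen s (n1 + m) [:: a])%N.
  by elim: m => // m IH; rewrite addnS (leq_ltn_trans IH) // grow // leq_addr.
move=> L; exists (n1 + L)%N => n a nL.
rewrite (leq_trans _ (_ : n - n1 <= _)%N) ?leq_subRL ?(leq_trans _ nL) ?leq_addr //.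
by have := lb (n - n1)%N a; rewrite subnKC // (leq_trans _ nL) ?leq_addr.
Qed.

End Lengths.

(** * Two-sided sequences and their windows *)

Section Topology.
Context {A : finType}.
Implicit Types u v : biinfinite A.

#[local] Instance biinfinite_nbhs_filter u : ProperFilter (nbhs u).
Proof. exact: (@nbhs_pfilter (biinfinite A : topologicalType) u). Qed.

Lemma nbhs_coordinate u (i : int) : nbhs u [set v | v i = u i].
Proof.
exact: (@proj_continuous int (fun=> discrete_topology A) i u _ (discrete_set1 _)).
Qed.

Lemma nbhs_cylinder u (I : seq int) : nbhs u [set v | forall i, i \in I -> v i = u i].
Proof.
elim: I => [|i I IH]; first by apply: filterS filterT => v _ i; rewrite in_nil.
apply: filterS (filterI (nbhs_coordinate u i) IH) => v [/= vi vI] j.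
by rewrite inE => /predU1P[->//|/vI].
Qed.

Lemma continuous_coordinatewise (f : biinfinite A -> biinfinite A) :
  (forall u i, \forall v \near u, f v i = f u i) -> continuous f.
Proof.
move=> fi u; apply/cvg_sup => i U /= [B [[C oC <-] /= fuB] BU].
apply: filterS (fi u i) => v fv; apply: BU => /=.
by rewrite /preimage /= fv.
Qed.

Definition window u (i : int) n : seq A := [seq u (i + j%:Z) | j <- iota 0 n].

Lemma size_window u i n : size (window u i n) = n.
Proof. by rewrite size_map size_iota. Qed.

Lemma nth_window x0 u i n k : (k < n)%N -> nth x0 (window u i n) k = u (i + k%:Z).
Proof. by move=> kn; rewrite (nth_map 0%N) ?size_iota // nth_iota. Qed.

Lemma windowD u i m n : window u i (m + n) = window u i m ++ window u (i + m%:Z) n.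
Proof.
rewrite /window iotaD map_cat add0n; congr (_ ++ _).
rewrite -[in LHS](addn0 m) iotaDl -map_comp; apply: eq_map => j /=.
by rewrite PoszD addrA.
Qed.

Lemma window_eq u v i n :
  (forall j, i <= j < i + n%:Z -> u j = v j) -> window u i n = window v i n.
Proof. by move=> uv; apply/eq_in_map => j; rewrite mem_iota => jn; apply: uv; lia. Qed.

Lemma window_eqE u v i n j :
  window u i n = window v i n -> i <= j < i + n%:Z -> u j = v j.
Proof.
move=> /(congr1 (nth (u 0)^~ (`|j - i|%N))) uv /andP[ij jn].
have kn : (`|j - i| < n)%N by lia.
have jE : j = i + `|j - i|%N%:Z by lia.
by rewrite jE; move: uv; rewrite !nth_window.
Qed.

Definition shiftn (k : nat) u : biinfinite A := fun i => u (i + k%:Z).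

Lemma shiftn0 u : shiftn 0 u = u.
Proof. by apply/funext => i; rewrite /shiftn addr0. Qed.

Lemma shiftnD k l u : shiftn (k + l) u = shiftn k (shiftn l u).
Proof. by apply/funext => i; rewrite /shiftn PoszD addrA. Qed.

Lemma shiftnS k u : shiftn k.+1 u = shift (shiftn k u).
Proof. by rewrite -addn1 addnC shiftnD. Qed.

Lemma shiftE u : shift u = shiftn 1 u.
Proof. by rewrite shiftnS shiftn0. Qed.

Lemma shiftnSr k u : shiftn k.+1 u = shiftn k (shift u).
Proof. by rewrite -addn1 shiftnD. Qed.

Lemma window_shiftn k u i n : window (shiftn k u) i n = window u (i + k%:Z) n.
Proof. by apply: eq_map => j; rewrite /shiftn addrAC. Qed.

Lemma window1 u i : window u i 1 = [:: u i].
Proof. by rewrite /window /= addr0. Qed.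

Lemma windowS u i n : window u i n.+1 = u i :: window u (i + 1) n.
Proof. by rewrite -add1n windowD window1. Qed.

Section Subst.
Variable s : substitution A.

Lemma size_flatten_ge (T : Type) (f : nat -> seq T) k :
  (forall j, (0 < size (f j))%N) -> (k <= size (flatten [seq f j | j <- iota 0 k]))%N.
Proof.
move=> f0; rewrite size_flatten /shape -map_comp sumnE big_map.
rewrite -[X in (X <= _)%N](size_iota 0 k) -sum1_size.
by apply: leq_sum => j _; exact: f0.
Qed.

(** The letter at position k of a concatenation of non-empty words depends on
    the first k+1 words only. *)
Lemma nth_flatten_iota (T : Type) (x0 x1 : T) (f : nat -> seq T) k j :
  (forall j, (0 < size (f j))%N) ->
  (k < size (flatten [seq f j | j <- iota 0 j]))%N ->
  nth x0 (flatten [seq f j | j <- iota 0 k.+1]) k =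
  nth x1 (flatten [seq f j | j <- iota 0 j]) k.
Proof.
move=> f0 kj; have kk := @size_flatten_ge _ f k.+1 f0.
case: (leqP j k.+1) => jk.
  rewrite -(subnKC jk) iotaD map_cat flatten_cat nth_cat kj.
  exact: set_nth_default.
rewrite -(subnKC (ltnW jk)) iotaD map_cat flatten_cat nth_cat kk.
exact: set_nth_default.
Qed.

Lemma window_subst_right u m :
  window (subst_biinfinite s u) 0 (size (subst_word s (window u 0 m))) =
    subst_word s (window u 0 m).
Proof.
apply: (@eq_from_nth _ (u 0)); rewrite size_window // => k km.
rewrite nth_window // add0r /= /subst_word -map_comp.
rewrite [in RHS](@eq_map _ _ _ (fun j : nat => s (u j))); last by move=> j;
  rewrite /= add0r.
apply: nth_flatten_iota => [j|]; first exact: subst_nonerasing.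
by move: km; rewrite /subst_word -map_comp.
Qed.

Lemma rev_window u m : rev (window u (- m%:Z) m) = [seq u (Negz j) | j <- iota 0 m].
Proof.
apply: (@eq_from_nth _ (u 0));
  rewrite size_rev size_window ?size_map ?size_iota // => k km.
rewrite nth_rev size_window // nth_window; last by lia.
rewrite (nth_map 0%N) ?size_iota // nth_iota //; congr (u _).
rewrite NegzE; lia.
Qed.

Lemma rev_subst_word w : rev (subst_word s w) = flatten [seq rev (s a) | a <- rev w].
Proof. by rewrite /subst_word rev_flatten -map_comp -map_rev. Qed.

Lemma window_subst_left u m (l := size (subst_word s (window u (- m%:Z) m))) :
  window (subst_biinfinite s u) (- l%:Z) l = subst_word s (window u (- m%:Z) m).
Proof.
apply: (can_inj (@revK A)); rewrite rev_window rev_subst_word rev_window -map_comp.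
apply: (@eq_from_nth _ (u 0)).
  by rewrite size_map size_iota /l -size_rev rev_subst_word rev_window -map_comp.
rewrite size_map size_iota => k kl.
rewrite (nth_map 0%N) ?size_iota // nth_iota // add0n /=.
apply: (@nth_flatten_iota _ _ _ (fun j => rev (s (u (Negz j))))) => [j|].
  by rewrite size_rev subst_nonerasing.
by move: kl; rewrite /l -size_rev rev_subst_word rev_window -map_comp.
Qed.

Definition iterbi n u := iter n (subst_biinfinite s) u.

Lemma window_iterbi_right n u m :
  window (iterbi n u) 0 (iterlen s n (window u 0 m)) = iterword s n (window u 0 m).
Proof.
elim: n => [|n IH]; first by rewrite /iterlen /= size_window.
by rewrite /iterlen /= -IH window_subst_right.
Qed.

Lemma window_iterbi_left n u m :
  window (iterbi n u) (- (iterlen s n (window u (- m%:Z) m))%:Z)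
    (iterlen s n (window u (- m%:Z) m)) = iterword s n (window u (- m%:Z) m).
Proof.
elim: n => [|n IH]; first by rewrite /iterlen /= size_window.
have -> : iterlen s n.+1 (window u (- m%:Z) m) =
  size (subst_word s (iterword s n (window u (- m%:Z) m))).
  by [].
by rewrite -[in LHS]IH window_subst_left IH.
Qed.

(** Windows around 0 determine a point, so this identity characterizes
    sigma^n(u) on both sides of the origin. *)
Lemma window_iterbi n u j m :
  window (iterbi n u) (- (iterlen s n (window u (- j%:Z) j))%:Z)
    (iterlen s n (window u (- j%:Z) (j + m))) =
  iterword s n (window u (- j%:Z) (j + m)).
Proof.
rewrite windowD addNr iterword_cat iterlen_cat windowD addNr.
by rewrite window_iterbi_left window_iterbi_right.
Qed.

Lemma biinfinite_eq u v :
  (forall k, exists i n m, [/\ (k <= i)%N, (k <= m)%N, n = (i + m)%N &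
     window u (- i%:Z) n = window v (- i%:Z) n]) -> u = v.
Proof.
move=> uv; apply/funext => i; have [a [n [m [ka km -> /window_eqE]]]] := uv `|i|.+1.
by apply; lia.
Qed.

(** Both sides have the same windows around 0, computed from the windows of u
    by [window_iterbi]. *)
Lemma iterbi_shift n u : iterbi n (shift u) =
  shiftn (iterlen s n [:: u 0]) (iterbi n u).
Proof.
apply: biinfinite_eq => k; set c := iterlen s n [:: u 0].
have uE j : window (shift u) (- j.+1%:Z) j.+1 = window u (- j%:Z) j ++ [:: u 0].
  rewrite shiftE window_shiftn -addn1 windowD window1.
  by congr (window _ _ _ ++ [:: u _]); lia.
have wE j m : window (shift u) (- j.+1%:Z) (j.+1 + m) = window u (- j%:Z) (j + m.+1).
  rewrite windowD uE addNr windowD windowS addNr -catA /=; congr (_ ++ _ :: _).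
  by rewrite shiftE window_shiftn.
pose a := iterlen s n (window (shift u) (- k.+1%:Z) k.+1).
pose b := iterlen s n (window (shift u) 0 k).
exists a, (a + b)%N, b; split=> //.
- by rewrite /a (leq_trans _ (iterlen_ge _ _ _)) // size_window.
- by rewrite /b (leq_trans _ (iterlen_ge _ _ _)) // size_window.
have abE : (a + b)%N = iterlen s n (window (shift u) (- k.+1%:Z) (k.+1 + k)).
  by rewrite windowD iterlen_cat addNr.
rewrite [in LHS]abE window_iterbi wE -window_iterbi window_shiftn.
congr (window _ _ _); last by rewrite abE wE.
by rewrite /a uE iterlen_cat -/c; lia.
Qed.

Lemma iterbi_shiftn n k u :
  iterbi n (shiftn k u) = shiftn (iterlen s n (window u 0 k)) (iterbi n u).
Proof.
elim: k u => [|k IH] u; first by rewrite /window /= iterlen_nil !shiftn0.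
rewrite shiftnSr IH iterbi_shift -shiftnD;
  apply: (congr1 (fun k => shiftn k (iterbi n u))).
rewrite windowS [in RHS]iterlen_cons add0r [RHS]addnC; congr (iterlen _ _ _ + _)%N.
by rewrite shiftE window_shiftn.
Qed.

Lemma iterbiD m n u : iterbi (m + n) u = iterbi m (iterbi n u).
Proof. exact: iterD. Qed.

Lemma subst_continuous : continuous (subst_biinfinite s).
Proof.
apply: continuous_coordinatewise => u i.
pose ctr := iota 0 `|i|.+2.
apply: filterS (nbhs_cylinder u (0 :: [seq Posz j | j <- ctr] ++ map Negz ctr)).
move=> v vu; have v0 : v 0 = u 0 by apply: vu; rewrite mem_head.
have vP j : j \in ctr -> v (Posz j) = u (Posz j).
  by move=> jc; apply: vu; rewrite in_cons mem_cat map_f ?orbT.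
have vN j : j \in ctr -> v (Negz j) = u (Negz j).
  by move=> jc; apply: vu; rewrite in_cons mem_cat [X in _ || (_ || X)]map_f ?orbT.
case: i @ctr vu vP vN => n ctr vu vP vN;
  rewrite /subst_biinfinite v0; congr (nth _ (flatten _) _);
  apply/eq_in_map => j; rewrite mem_iota => jn; rewrite ?vP ?vN // mem_iota;
  by move: jn => /=; lia.
Qed.

Lemma shift_continuous : continuous (@Defs.shift A).
Proof.
by apply: continuous_coordinatewise => u i; apply: filterS (nbhs_coordinate u (i + 1)).
Qed.

End Subst.

End Topology.

(** * Desubstitution *)

Section Desubstitution.
Context {A : finType} (s : substitution A) (Omega : set (biinfinite A)).
Context (OmegaP : substitution_subshift s Omega).
Implicit Types u v : biinfinite A.

Lemma subshift_shiftn k u : Omega u -> Omega (shiftn k u).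
Proof.
have [[_ _ _ sO] _] := OmegaP.
elim: k u => [|k IH] u Ou; first by rewrite shiftn0.
by rewrite shiftnSr; apply/IH/sO; exists u.
Qed.

Lemma subshift_iterbi n u : Omega u -> Omega (iterbi s n u).
Proof.
have [[_ _ sO _] _] := OmegaP.
by move=> Ou; elim: n => //= n IH; apply: sO; exists (iterbi s n u).
Qed.

Lemma shorten_desubstitution k v : Omega v ->
  exists v' k', [/\ Omega v', (k' < size (s (v' 0)))%N &
    shiftn k (subst_biinfinite s v) = shiftn k' (subst_biinfinite s v')].
Proof.
elim/ltn_ind: k v => k IH v Ov; case: (ltnP k (size (s (v 0)))) => kv.
  by exists v, k.
have kk : (k - size (s (v 0)) < k)%N
  by rewrite ltn_subrL subst_nonerasing (leq_trans _ kv) // subst_nonerasing.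
have Ov1 : Omega (shift v) by rewrite shiftE; exact: subshift_shiftn.
have [v' [k' [Ov' kv' vE]]] := IH _ kk _ Ov1.
exists v', k'; split=> //; rewrite -vE.
rewrite -[subst_biinfinite s (shift v)]/(iterbi s 1 _) iterbi_shift -shiftnD.
by apply: (congr1 (shiftn^~ _)); rewrite /iterlen /= /subst_word /= cats0 subnK.
Qed.

(** The right-hand sides form a compact set that is stable under sigma and S,
    so it contains Omega by minimality. *)
Lemma desubstitution u : Omega u ->
  exists v k, [/\ Omega v, (k < size (s (v 0)))%N & u =
    shiftn k (subst_biinfinite s v)].
Proof.
have [[[u0 Ou0] cO sO shO] minO] := OmegaP.
pose K := \max_a size (s a).
pose X := \bigcup_(k < K) ((fun v => shiftn k (subst_biinfinite s v)) @` Omega).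
have XP v k : Omega v -> X (shiftn k (subst_biinfinite s v)).
  move=> /(@shorten_desubstitution k)[v' [k' [Ov' kv' ->]]].
  by exists k'; [rewrite /= (leq_trans kv') // leq_bigmax|exists v'].
suff OX : Omega `<=` X.
  by move=> /OX[k _ [v /(@shorten_desubstitution k)[v' [k' [? ? ->]]] <-]];
    exists v', k'.
apply: minO; split.
- by exists (shiftn 0 (subst_biinfinite s u0)); apply: XP.
- rewrite /X bigcup_mkord; apply: bigsetU_compact => k _.
  apply: continuous_compact => //; apply: continuous_subspaceT.
  move: (k : nat) => {}k; elim: k => [|k IH] x.
    by rewrite (_ : (fun v => _) = subst_biinfinite s);
      [exact: subst_continuous|apply/funext=> v; rewrite shiftn0].
  rewrite (_ : (fun v => _) = @Defs.shift A \o (fun v =>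
    shiftn k (subst_biinfinite s v))).
    by apply: continuous_comp; [exact: IH|exact: shift_continuous].
  by apply/funext=> v; rewrite shiftnS.
- move=> _ [_ [k _ [v Ov <-]] <-].
  rewrite -[subst_biinfinite s (shiftn _ _)]/(iterbi s 1 _) iterbi_shiftn.
  by apply: XP; apply: sO; exists v.
- by move=> _ [_ [k _ [v Ov <-]] <-]; rewrite -shiftnS; exact: XP.
Qed.

(** The point u is cut into words sigma^n(a), a running through the letters of
    v, and its origin lies at position k of the word that comes from the
    letter of v at 0. Such a pair (v, k) need not be unique. *)
Definition address n u v k :=
  [/\ Omega v, (k < iterlen s n [:: v 0])%N & u = shiftn k (iterbi s n v)].

Lemma window0_eq u v n : (forall j : nat, (j < n)%N -> u j = v j) ->
  window u 0 n = window v 0 n.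
Proof. by move=> uv; apply: window_eq => -[j|j] jn; [apply: uv|]; lia. Qed.

(** A prefix of sigma^n(v) is the image of a prefix of v followed by a proper
    prefix of the image of the next letter. *)
Lemma split_window n v k : exists j r,
  [/\ (r < iterlen s n [:: v j%:Z])%N, k = (iterlen s n (window v 0 j) + r)%N,
      (j <= k)%N &
   window (iterbi s n v) 0 k =
   iterword s n (window v 0 j) ++ take r (iterword s n [:: v j%:Z])].
Proof.
suff [j [r [rj kE]]] : exists j r, (r < iterlen s n [:: v j%:Z])%N /\ k =
  (iterlen s n (window v 0 j) + r)%N.
  exists j, r; split=> //.
    rewrite kE (leq_trans _ (leq_addr _ _)) //.
    by rewrite -[X in (X <= _)%N](size_window v 0) iterlen_ge.
  have jE : window v 0 j.+1 = window v 0 j ++ [:: v j].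
    by rewrite -addn1 windowD window1 add0r.
  have := window_iterbi_right s n v j.+1.
  rewrite jE iterword_cat iterlen_cat -{1}(subnKC (ltnW rj)) addnA windowD.
  move/(congr1 (take k)); rewrite take_size_cat ?size_window -?kE // => ->.
  by rewrite take_cat {1}kE -/(iterlen _ _ _) ltnNge leq_addr /= kE addKn.
elim: k => [|k [j [r [rj ->]]]].
  by exists 0%N, 0%N; rewrite iterlen1_gt0 /window /= iterlen_nil.
case: (ltnP r.+1 (iterlen s n [:: v j])) => rj'; first by exists j, r.+1; rewrite addnS.
exists j.+1, 0%N; split; first exact: iterlen1_gt0.
rewrite -(addn1 j) windowD window1 iterlen_cat add0r addn0 -addnS; congr (_ + _)%N.
by apply/eqP; rewrite eqn_leq rj' rj.
Qed.

Lemma address_exists n u : Omega u -> exists v k, address n u v k.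
Proof.
move=> Ou; elim: n => [|n [v [k [Ov kv ->]]]].
  by exists u, 0%N; split=> //; rewrite shiftn0.
have [w [l [Ow lw vE]]] := desubstitution Ov.
exists w, (k + iterlen s n (window (subst_biinfinite s w) 0 l))%N; split=> //;
  last first.
  by rewrite vE iterbi_shiftn -shiftnD -[subst_biinfinite s w]/(iterbi s 1 w)
    -iterbiD addn1.
have lE : iterlen s 1 [:: w 0] = (l + (1 + (size (s (w 0)) - l.+1)))%N.
  by rewrite /iterlen /= /subst_word /= cats0 addnA addn1 subnKC.
have := window_iterbi_right s 1 w 1; rewrite window1 lE windowD windowD => wE.
have -> : iterlen s n.+1 [:: w 0] = iterlen s n (iterword s 1 [:: w 0])
  by rewrite -iterlenD addn1.
rewrite -wE !iterlen_cat addnC ltn_add2l window1 ltn_addr //.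
by move: kv; rewrite vE /shiftn.
Qed.

End Desubstitution.

Section Agreement.
Context {A : finType} (s : substitution A) (Omega : set (biinfinite A)).
Context (prop : proper_subst s).
Context (lenoo : forall L, exists n0, forall n a, (n0 <= n)%N ->
  (L <= iterlen s n [:: a])%N).
Implicit Types u v : biinfinite A.

(** Right of the word sigma^n(b), b being the common letter at 0, both points
    continue with sigma^(n-1)(a0), where every image of a letter starts with
    a0; likewise on the left. *)
Lemma address_agreement L : exists n0, forall n u v u' v' k, (n0 <= n)%N ->
  address s Omega n u u' k -> address s Omega n v v' k -> u' 0 = v' 0 ->
  forall i : int, - L%:Z <= i < L%:Z -> u i = v i.
Proof.
have [[a0 left_a0] [a1 right_a1]] := prop; have [n0 Hn0] := lenoo L.
exists n0.+1 => -[//|n] u v u' v' k; rewrite ltnS => n0n [_ ku ->] [_ kv ->] uv0 i iL.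
have right w :
    window (iterbi s n.+1 w) 0 (iterlen s n.+1 [:: w 0] + iterlen s n [:: a0]) =
    iterword s n.+1 [:: w 0] ++ iterword s n [:: a0].
  have := window_iterbi_right s n.+1 w 2;
    rewrite windowS window1 add0r -cat1s iterword_cat iterlen_cat.
  have /prefixP[r sE] := left_a0 (w 1).
  have wE : iterword s n.+1 [:: w 1] = iterword s n [:: a0] ++ iterword s n r.
    by rewrite iterwordSr /subst_word /= cats0 sE iterword_cat.
  have -> : iterlen s n.+1 [:: w 1] = (iterlen s n [:: a0] + iterlen s n r)%N
    by rewrite /iterlen wE size_cat.
  rewrite wE addnA windowD catA => /(congr1 (take (iterlen s n.+1 [:: w 0] +
    iterlen s n [:: a0]))).
  by rewrite !take_size_cat ?size_window ?size_cat.
have left w :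
    window (iterbi s n.+1 w) (- (iterlen s n [:: a1])%:Z) (iterlen s n [:: a1]) =
    iterword s n [:: a1].
  have := window_iterbi_left s n.+1 w 1; rewrite window1.
  set c := w _; have /suffixP[r sE] := right_a1 c.
  have wE : iterword s n.+1 [:: c] = iterword s n r ++ iterword s n [:: a1].
    by rewrite iterwordSr /subst_word /= cats0 sE iterword_cat.
  have -> : iterlen s n.+1 [:: c] = (iterlen s n r + iterlen s n [:: a1])%N
    by rewrite /iterlen wE size_cat.
  rewrite wE windowD => /(congr1 (drop (iterlen s n r))).
  rewrite !drop_size_cat ?size_window // => <-.
  by congr (window _ _ _); lia.
rewrite /shiftn; have l0 := Hn0 n a0 n0n; have l1 := Hn0 n a1 n0n.
case: (leP 0 (i + k%:Z)) => ik.
  have E := right u'; rewrite uv0 -(right v') in E; rewrite uv0 in ku.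
  by apply: (window_eqE E); move: ku kv l0 iL ik;
    move: (iterlen _ _ _) (iterlen _ _ _) => x y; lia.
have E := left u'; rewrite -(left v') in E.
by apply: (window_eqE E); move: l1 iL ik; move: (iterlen _ _ _) => x; lia.
Qed.

Lemma take_iterlen_inj l k k' (w : seq A) : (k <= size w)%N -> (k' <= size w)%N ->
  iterlen s l (take k w) = iterlen s l (take k' w) -> k = k'.
Proof.
move=> kw k'w E; wlog kk : k k' kw k'w E / (k <= k')%N => [H|].
  by case: (leqP k k') => [|/ltnW] kk; [apply: H|apply/esym; apply: H].
move: E; rewrite -[take k' w](cat_take_drop k) take_takel // iterlen_cat => /eqP.
rewrite -{1}(addn0 (iterlen _ _ _)) eqn_add2l eq_sym => /eqP l0.
have := iterlen_ge s (drop k (take k' w)) l;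
  rewrite l0 size_drop size_takel // leqn0 subn_eq0 => k'k.
by apply/eqP; rewrite eqn_leq kk.
Qed.

End Agreement.

(** Finitely many distinct points already differ on a common finite window,
    where at most #|T| patterns occur. *)
Lemma finite_set_separated (A : finType) (U : set (biinfinite A)) (T : finType) :
  (forall L, exists code : biinfinite A -> T, forall u v, U u -> U v ->
    code u = code v ->
     forall i : int, - L%:Z <= i < L%:Z -> u i = v i) ->
  finite_set U.
Proof.
move=> HU; apply: contrapT => infU.
have [D DU cD] := infinite_set_fset #|T|.+1 infU.
have /choice[sep sepP] : forall uv : biinfinite A * biinfinite A,
    exists i, uv.1 <> uv.2 -> uv.1 i <> uv.2 i.
  move=> [u v]; apply: contrapT => H; have uv : u <> v by move=> uv; apply: H; exists 0.
  by apply: uv; apply/funext => i; apply: contrapT => ui; apply: H; exists i.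
pose L := (\max_(u <- D) \max_(v <- D) `|sep (u, v)|.+1)%N.
have [code Hcode] := HU L.
have inj : {in D &, injective code}.
  move=> u v uD vD cuv; apply: contrapT => /(sepP (u, v)) /=; apply.
  apply: (Hcode u v (DU u uD) (DU v vD) cuv).
  have : (`|sep (u, v)| < L)%N.
    rewrite /L (big_rem u) //= leq_max; apply/orP; left.
    by rewrite (big_rem v) //= leq_max leqnn.
  by move: (sep (u, v)) (L) => x l; lia.
have : (#|` D| <= #|T|)%N.
  rewrite -(size_map code) -(card_uniqP _) ?max_card // map_inj_in_uniq ?fset_uniq //.
by move/(leq_trans cD); rewrite ltnn.
Qed.

(** * The torus and the density of the powers of a Pisot number *)

Section Torus.
Context {R : realType} {d : nat}.

Definition to_torus (x : 'rV[R]_d) : torus R d := (\pi_(torus R d) x)%qT.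

Lemma to_torusD x y : to_torus (x + y) = to_torus x + to_torus y.
Proof. exact: raddfD. Qed.

Lemma to_torusMz x (n : int) : to_torus (x *~ n) = to_torus x *~ n.
Proof. exact: raddfMz. Qed.

Lemma to_torus_eq x y :
  to_torus x = to_torus y <-> forall i, x 0 i - y 0 i \is a Num.int.
Proof.
have -> : (to_torus x = to_torus y) <-> (x - y \in @integer_vector R d).
  rewrite Quotient.idealrBE; split=> [xy|/eqP//]; exact/eqP.
rewrite unfold_in; split=> [/forallP xy i|xy]; first by have := xy i; rewrite !mxE.
by apply/forallP => i; rewrite !mxE.
Qed.

Lemma to_torus_repr z : to_torus (repr z) = z.
Proof. exact: reprK. Qed.

Lemma to_torus_continuous : continuous to_torus.
Proof. by apply/continuousP => U; rewrite /open /=. Qed.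

End Torus.

Section Weights.
Context {R : realType} (beta : R).
Implicit Types (g h : nat -> R).

(** The sum of beta^(i-j) g j over j <= i; [horner_diff] is its inverse in g. *)
Fixpoint horner_sum g i : R :=
  if i is i'.+1 then beta * horner_sum g i' + g i else g 0%N.

Definition horner_diff (h : nat -> R) i : R :=
  if i is i'.+1 then h i - beta * h i' else h 0%N.

Lemma horner_diffK h i : horner_sum (horner_diff h) i = h i.
Proof. by elim: i => //= i ->; rewrite addrC subrK. Qed.

Lemma horner_sumK g i : horner_diff (horner_sum g) i = g i.
Proof. by case: i => //= i; rewrite addrAC subrr add0r. Qed.

Lemma horner_diff_eq g h i : (forall j, (j <= i)%N -> g j = h j) ->
  horner_diff g i = horner_diff h i.
Proof. by case: i => [|i] gh /=; rewrite !gh. Qed.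

Lemma horner_sumB g h i :
  horner_sum (fun j => g j - h j) i = horner_sum g i - horner_sum h i.
Proof. by elim: i => //= i ->; ring. Qed.

Lemma horner_sum_eq g h i : (forall j, (j <= i)%N -> g j = h j) ->
  horner_sum g i = horner_sum h i.
Proof.
elim: i => [|i IH] gh /=; first exact: gh.
by rewrite gh // IH // => j ji; rewrite gh // ltnW.
Qed.

Lemma horner_sum_telescope (t : nat -> R) i :
  horner_sum (fun j => beta * t j - t j.+1) i = beta ^+ i.+1 * t 0%N - t i.+1.
Proof. by elim: i => [|i /= ->]; [rewrite expr1|rewrite [in RHS]exprS; ring]. Qed.

Lemma horner_sum_le g e i : 0 <= beta -> (forall j, (j <= i)%N -> `|g j| <= e) ->
  `|horner_sum g i| <= e * horner_sum (fun=> 1) i.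
Proof.
move=> b0; elim: i => [|i IH] ge /=; first by rewrite mulr1 ge.
rewrite (le_trans (ler_normD _ _)) // mulrDr mulr1 lerD ?ge //.
rewrite normrM (ger0_norm b0) mulrCA ler_wpM2l // IH // => j ji.
by rewrite ge // leqW.
Qed.

Lemma horner_sum1_ge0 i : 0 <= beta -> 0 <= horner_sum (fun=> 1) i.
Proof. by move=> b0; elim: i => //= i IH; rewrite addr_ge0 ?mulr_ge0. Qed.

End Weights.

Section Density.
Context {R : realType} (beta : R) (d : nat) (P : {poly int}) (Q : {poly R}).
Context (pis : pisot_recurrence beta d P Q).

Let b0 : 0 <= beta. Proof. by case: pis => /ltW/(le_trans ler01). Qed.

(** Extend x to a Q-recurrent sequence, n steps into the past. There, choose
    t_0, ..., t_d greedily so that the differences match the first d terms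
    within 1, and continue t as a P-recurrent sequence. The error is
    Q-recurrent, hence of order rho^n when the present is reached. *)
Lemma approximate_differences (x : nat -> R) e : 0 < e -> exists t : nat -> int,
  forall j, (j < d)%N -> `|beta * (t j)%:~R - (t j.+1)%:~R - x j| < e.
Proof.
move=> e0; have [rs QE rs1] := pisot_contract pis.
have [rho [C [rho01 C0 H]]] := recur_decayR QE rs1.
have srs : size rs = d.
  apply: succn_inj; rewrite -(size_prod_XsubC rs id) -QE size_map_poly.
  exact: (pisot_cofactor_size pis).
have C1 : 0 < C + 1 by lra.
have [n /(_ _)Hn] := expr_lt_eventually rho01 (divr_gt0 e0 C1).
have [z zx zQ] := recur_extend x (pisot_cofactor_monic pis).
have [w wz wQ] := recur_extend_back n (pisot_cofactor_unit pis) zQ.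
(* Greedy choice, with errors in [0, 1). *)
pose t0 := fix t0 j : int := if j is j'.+1 then Num.floor (beta * (t0 j')%:~R - w j')
  else 0.
have [_ mP sP _ _ _] := pis.
have [t tt0 tP] := recur_extend t0 mP.
pose y j : R := beta * (t j)%:~R - (t j.+1)%:~R - w j.
have yn m : `|y m| <= 1 * C * rho ^+ m.
  apply: H => // [i|j].
    by rewrite recur_sub wQ subr0 (recur_pisot pis) tP oppr0.
  rewrite srs => jd; rewrite /y !tt0 ?sP //=; last exact: ltnW.
  have := floor_le (beta * (t0 j)%:~R - w j).
  have := floorD1_gt (beta * (t0 j)%:~R - w j); rewrite intrD1 => *.
  by rewrite ler_norml; apply/andP; split; lra.
exists (fun j => t (n + j)%N) => j jd.
have -> : x j = w (n + j)%N by rewrite wz zx // (pisot_cofactor_size pis).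
rewrite addnS; apply: (le_lt_trans (yn _)); rewrite mul1r.
have := Hn (n + j)%N (leq_addr _ _); rewrite ltr_pdivlMr //.
have : 0 <= rho ^+ (n + j) by rewrite exprn_ge0 // ltW //; case/andP: rho01.
by move: (rho ^+ _) => r; nra.
Qed.

Lemma approximate_powers (theta : nat -> R) e : 0 < e -> exists t : nat -> int,
  forall i, (i < d)%N -> `|beta ^+ i.+1 * (t 0%N)%:~R - (t i.+1)%:~R - theta i| < e.
Proof.
move=> e0; pose W := \sum_(i < d) horner_sum beta (fun=> 1) i.
have W0 : 0 <= W by apply: sumr_ge0 => i _; exact: horner_sum1_ge0.
have W1 : 0 < W + 1 by lra.
have [t Ht] := approximate_differences (horner_diff beta theta) (divr_gt0 e0 W1).
exists t => i id.
rewrite -(horner_sum_telescope beta (fun j =>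
  (t j)%:~R)) -(horner_diffK beta theta) -horner_sumB.
have := @horner_sum_le R beta _ (e / (W + 1)) i b0 (fun j ji =>
  ltW (Ht j (leq_ltn_trans ji id))).
move/le_lt_trans; apply.
have Wi : horner_sum beta (fun=> 1) i <= W.
  rewrite /W (bigD1 (Ordinal id)) //= lerDl; apply: sumr_ge0 => *;
    exact: horner_sum1_ge0.
rewrite mulrAC ltr_pdivrMr // ltr_pM2l //; lra.
Qed.

(** For t as in [approximate_powers], the multiple t_0 of the translation
    vector is congruent modulo Z^d to a vector close to the target. *)
Lemma powers_minimal_translation :
  minimal_translation (to_torus (\row_(i < d) beta ^+ i.+1)).
Proof.
move=> x U [z Uz] oU.
have : nbhs (repr z : 'rV[R]_d) (to_torus @^-1` U).
  by apply: open_nbhs_nbhs; split; [exact: oU|rewrite /= to_torus_repr].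
move=> /nbhs_ballP[e /= e0 He].
pose theta i := if insub i is Some j then (repr z : 'rV[R]_d) 0 j - (repr x
  : 'rV[R]_d) 0 j else 0.
have [t Ht] := approximate_powers theta e0.
pose p : 'rV[R]_d := repr x + (\row_(i < d) beta ^+ i.+1) *~ t 0%N.
exists (to_torus p); split; last first.
  by exists (t 0%N) => //; rewrite to_torusD to_torusMz to_torus_repr.
pose q : 'rV[R]_d := \row_i (p 0 i - (t i.+1)%:~R).
have -> : to_torus p = to_torus q.
  by apply/to_torus_eq => i; rewrite [X in _ - X]mxE opprB addrC subrK intr_int.
apply: He; split=> // i j; rewrite ord1 /ball /= distrC.
have := Ht j (ltn_ord j); rewrite /theta valK.
have rowE : ((\row_(i < d) beta ^+ i.+1 : 'rV[R]_d) *~ t 0%N) 0 j =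
    beta ^+ j.+1 * (t 0%N)%:~R.
  by rewrite -scaler_int !mxE mulrC.
rewrite /q /p [X in _ -> `|X - _| < _]mxE [X in _ -> `|X - _ - _| < _]mxE rowE.
by congr (`|_| < _); ring.
Qed.

End Density.

(** * The transfer function *)

Section Transfer.
Context {R : realType} {A : finType} (s : substitution A) (Omega : set (biinfinite A)).
Context (OmegaP : substitution_subshift s Omega) (prim : primitive_subst s).
Context (beta C rho : R).
Implicit Types u v : biinfinite A.
Local Notation defect := (defect s beta).

Context (C0 : 0 <= C) (rho01 : 0 < rho < 1).
Context (defect_decay : forall n a, `|defect (iterword s n [:: a])| <= C * rho ^+ n).

Let rho0 : 0 < rho. Proof. by case/andP: rho01. Qed.
Let rho1 : rho < 1. Proof. by case/andP: rho01. Qed.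
Let rhoX n : 0 <= rho ^+ n. Proof. by rewrite exprn_ge0 // ltW. Qed.
Local Hint Resolve rhoX : core.

Lemma defect_iterword_le n (w : seq A) :
  `|defect (iterword s n w)| <= (size w)%:R * (C * rho ^+ n).
Proof.
elim: w => [|a w IH]; first by rewrite iterword_nil defect_nil normr0 mul0r.
rewrite -cat1s iterword_cat defect_cat (le_trans (ler_normD _ _)) //= -natr1 mulrDl
  mul1r addrC.
exact: lerD.
Qed.

Let K := (\max_a size (s a))%N.
(** The sum of the geometric series of [defect_window_depth], with two ends of
    at most K letters at each step. *)
Definition defect_bound : R := 2 * K%:R * C / (1 - rho).
Local Notation B := defect_bound.

Lemma defect_bound_ge0 : 0 <= B.
Proof. by rewrite divr_ge0 ?mulr_ge0 // subr_ge0 ltW. Qed.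

(** Desubstitute D times: each step leaves two ends of bounded length, whose
    defects form a geometric series, and after D steps the number of letters
    is still at most j. *)
Lemma defect_window_depth D n u j : Omega u ->
  `|defect (iterword s n (window u 0 j))| <=
     B * (rho ^+ n - rho ^+ (n + D)) + j%:R * (C * rho ^+ (n + D)).
Proof.
elim: D n u j => [|D IH] n u j Ou.
  rewrite addn0 subrr mulr0 add0r -[X in X%:R](size_window u 0).
  exact: defect_iterword_le.
have [v [k [Ov kv uE]]] := desubstitution OmegaP Ou.
have [j' [r [rj kjE j'k wE]]] := split_window s 1 v (k + j).
have j'j : (j' <= j)%N.
  case: j' {rj wE} kjE j'k => // j' kjE _; move: kjE.
  rewrite windowS iterlen_cons -[iterlen s 1 [:: _]]/(size (flatten _)) /= cats0.
  have := iterlen_ge s (window v (0 + 1) j') 1; rewrite size_window.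
  by move: (iterlen _ _ _) (size _) kv => a b; lia.
have rK : (r <= K)%N.
  apply: (leq_trans (ltnW rj)); rewrite -[iterlen s 1 [:: _]]/(size (flatten _)) /=
    cats0.
  exact: leq_bigmax.
have kK : (k <= K)%N by apply: (leq_trans (ltnW kv)); exact: leq_bigmax.
have uw : window u 0 j = window (iterbi s 1 v) (0 + k%:Z) j by rewrite uE window_shiftn.
move: wE; rewrite windowD -uw => /(congr1 (fun w => defect (iterword s n w))).
rewrite !iterword_cat !defect_cat -iterwordD addn1.
set p := window _ _ k; set q := take _ _ => E.
have pK : `|defect (iterword s n p)| <= K%:R * (C * rho ^+ n).
  rewrite (le_trans (defect_iterword_le _ _)) // ler_wpM2r ?mulr_ge0 //.
  by rewrite ler_nat size_window.
have qK : `|defect (iterword s n q)| <= K%:R * (C * rho ^+ n).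
  rewrite (le_trans (defect_iterword_le _ _)) // ler_wpM2r ?mulr_ge0 //.
  by rewrite ler_nat size_takel // ltnW.
have -> : defect (iterword s n (window u 0 j)) =
  defect (iterword s n.+1 (window v 0 j')) +
    defect (iterword s n q) - defect (iterword s n p).
  by rewrite -E; ring.
have IHv := IH n.+1 v j' Ov.
have jj : j'%:R * (C * rho ^+ (n.+1 + D)) <= j%:R * (C * rho ^+ (n.+1 + D)).
  by rewrite ler_wpM2r ?mulr_ge0 // ler_nat.
have BE : B * rho ^+ n = B * rho ^+ n.+1 + 2 * (K%:R * (C * rho ^+ n)).
  rewrite exprSr /defect_bound; field.
  by rewrite subr_eq0 gt_eqF.
rewrite addnS -addSn; apply: (le_trans (ler_normB _ _)).
apply: (le_trans (lerD (ler_normD _ _) (lexx _))).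
rewrite mulrBr BE.
lra.
Qed.

Lemma defect_window n u j : Omega u ->
  `|defect (iterword s n (window u 0 j))| <= B * rho ^+ n.
Proof.
move=> Ou; apply/ler_addgt0Pr => e e0.
have jC : 0 < j%:R * C + 1 by rewrite ltr_wpDl // mulr_ge0.
have [D HD] := expr_lt_eventually rho01 (divr_gt0 e0 jC).
have := defect_window_depth D n j Ou; have := HD D (leqnn _).
rewrite ltr_pdivlMr //.
have : rho ^+ (n + D) <= rho ^+ D by rewrite exprD ler_piMl // exprn_ile1 // ltW.
have := defect_bound_ge0; have := rhoX (n + D); have := rhoX D.
have : 0 <= j%:R * C by rewrite mulr_ge0.
rewrite !mulrBr mulrA; move: (j%:R * C) (rho ^+ D) (rho ^+ (n+D)) B (rho ^+n) =>
  x y z b t.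
move=> *; nra.
Qed.

(** A point of Omega is a concatenation of words sigma^n(a), each of which
    contains all letters when M^n is positive. *)
Lemma letters_recur : exists J, forall v b, Omega v ->
  exists j, (0 < j <= J)%N /\ v (Posz j) = b.
Proof.
have [n mem] := primitive_mem prim.
exists (\max_a iterlen s n [:: a] + \max_a iterlen s n [:: a])%N => v b Ov.
have [v' [k [Ov' kv' vE]]] := address_exists OmegaP n Ov.
have := mem (v' 1) b; rewrite -index_mem; set t := index _ _ => tl.
exists (iterlen s n [:: v' 0%Z] + t - k)%N; split.
  have M0 : (iterlen s n [:: v' 0%Z] <= \max_a iterlen s n [:: a])%N
    by exact: (leq_bigmax (F := fun a => iterlen s n [:: a])).
  have M1 : (iterlen s n [:: v' 1%Z] <= \max_a iterlen s n [:: a])%N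
    by exact: (leq_bigmax (F := fun a => iterlen s n [:: a])).
  move: tl kv' M0 M1; rewrite -/(iterlen s n [:: v' 1]).
  by move: (iterlen _ _ _) (iterlen _ _ _) (\max_(_ | _) _) => x y z; lia.
have w2 : window v' 0 2 = [:: v' 0%Z] ++ [:: v' 1%Z] by rewrite windowS window1.
have := window_iterbi_right s n v' 2;
  rewrite w2 iterlen_cat iterword_cat =>
    /(congr1 (nth b ^~ (iterlen s n [:: v' 0%Z] + t)%N)).
rewrite nth_window ?ltn_add2l // add0r nth_cat -/(iterlen _ _ _) ltnNge leq_addr /=
  addKn nth_index; last first.
  by rewrite -index_mem.
move=> <-; rewrite vE /shiftn; congr (iterbi s n v' _).
by rewrite -PoszD subnK // (leq_trans (ltnW kv')) ?leq_addr.
Qed.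

(** Prefixes are measured from the cutting points given by u' and v'. The
    prefix of u ends inside sigma^n(b) for some letter b of u', preceded by
    complete words of total defect O(rho^n); the same letter occurs in v' at a
    bounded distance, and the prefix of v that ends at the same place of that
    occurrence has nearly the same defect. *)
Lemma height_compare n : exists L, forall u v u' v' k k' i,
  address s Omega n u u' k -> address s Omega n v v' k' ->
  exists i2, (i2 <= L)%N /\
    defect (window (iterbi s n u') 0 k) + defect (window u 0 i) <=
    defect (window (iterbi s n v') 0 k') + defect (window v 0 i2) + 2 * B * rho ^+ n.
Proof.
have [J HJ] := letters_recur.
pose m := (\max_a iterlen s n [:: a])%N.
have lm a : (iterlen s n [:: a] <= m)%N by exact: (leq_bigmax (F :=
  fun a => iterlen s n [:: a])).
(* Each letter occurs among the first J letters after the origin of v', and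
   the words sigma^n(a) have at most m letters. *)
exists (J * m + m)%N => u v u' v' k k' i [Ou' ku' uE] [Ov' kv' vE].
have [j [r [rj kE _ wE]]] := split_window s n u' (k + i).
have [j2 [/andP[j20 j2J] vj2]] := HJ v' (u' j%:Z) Ov'.
have lj2 : (iterlen s n (window v' 0 j2) <= J * m)%N.
  rewrite iterlen_sum (@leq_trans (j2 * m)) ?leq_mul2r ?j2J ?orbT //.
  rewrite -[X in (_ <= X * _)%N](size_window v' 0) -sum1_size big_distrl /=.
  by apply: leq_sum => a _; rewrite mul1n.
have k'j2 : (k' < iterlen s n (window v' 0 j2))%N.
  by case: j2 j20 {j2J vj2 lj2} => // j2 _; rewrite windowS iterlen_cons ltn_addr.
exists (iterlen s n (window v' 0 j2) + r - k')%N; split.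
  by rewrite (leq_trans (leq_subr _ _)) // leq_add // (leq_trans (ltnW rj)).
have uw : window u 0 i = window (iterbi s n u') (0 + k%:Z) i
  by rewrite uE window_shiftn.
have vw l : window v 0 l = window (iterbi s n v') (0 + k'%:Z) l
  by rewrite vE window_shiftn.
rewrite vw uw -!defect_cat -!windowD wE defect_cat subnKC; last first.
  by rewrite (leq_trans (ltnW k'j2)) ?leq_addr.
have := window_iterbi_right s n v' j2.+1.
have -> : window v' 0 j2.+1 = window v' 0 j2 ++ [:: v' j2]
  by rewrite -addn1 windowD window1 add0r.
rewrite iterword_cat iterlen_cat vj2 -{1}(subnKC (ltnW rj)) addnA windowD.
move/(congr1 (take (iterlen s n (window v' 0 j2) + r)));
  rewrite take_size_cat ?size_window // => ->.
rewrite take_cat {1}/iterlen ltnNge leq_addr /= addKn defect_cat.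
have := defect_window n j Ou'; have := defect_window n j2 Ov'.
by rewrite !ler_norml => /andP[? ?] /andP[? ?]; lra.
Qed.

Definition height u : R := sup [set defect (window u 0 i) | i in [set: nat]].

Lemma height_ge u i : Omega u -> defect (window u 0 i) <= height u.
Proof.
move=> Ou; apply: ub_le_sup; last by exists i.
exists B => _ [j _ <-]; have := defect_window 0 j Ou.
by rewrite expr0 mulr1 => /ler_normlW.
Qed.

Lemma height_le u x : (forall i, defect (window u 0 i) <= x) -> height u <= x.
Proof.
move=> ux; apply: ge_sup; first by exists (defect (window u 0 0)), 0%N.
by move=> _ [i _ <-].
Qed.

(** Minus the supremum, because S shortens all prefixes by the first letter
    and thereby lowers the supremum by the defect of that letter, once it is
    known that the empty prefix does not matter. *)
Definition transfer u : R := - height u.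

Lemma transfer_bounded u : Omega u -> `|transfer u| <= B.
Proof.
move=> Ou; rewrite /transfer normrN ler_norml; apply/andP; split.
  have := height_ge 0 Ou; rewrite {1}/window /= defect_nil; have := defect_bound_ge0;
    lra.
apply: height_le => i; have := defect_window 0 i Ou.
by rewrite expr0 mulr1 => /ler_normlW.
Qed.

(** Up to O(rho^n), the transfer function minus the defect of the word from
    the cutting point to the origin is a constant that depends on n only. *)
Lemma transfer_address n u v u' v' k k' :
  address s Omega n u u' k -> address s Omega n v v' k' -> Omega v ->
  transfer v - defect (window (iterbi s n v') 0 k') <=
  transfer u - defect (window (iterbi s n u') 0 k) + 2 * B * rho ^+ n.
Proof.
move=> au av Ov; have [L HL] := height_compare n.
rewrite /transfer; suff : height u <= height v + defect (window (iterbi s n v') 0 k') -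
    defect (window (iterbi s n u') 0 k) + 2 * B * rho ^+ n by lra.
apply: height_le => i; have [i2 [_ ]] := HL _ _ _ _ _ _ i au av.
have := height_ge i2 Ov; lra.
Qed.

Lemma transfer_uniformly_continuous e : 0 < e -> exists L, forall u v, Omega u ->
  Omega v ->
  (forall j : nat, (j < L)%N -> u j = v j) -> `|transfer u - transfer v| <= e.
Proof.
move=> e0; have B0 : 0 < 2 * B + 1 by have := defect_bound_ge0; lra.
have [n Hn] := expr_lt_eventually rho01 (divr_gt0 e0 B0).
have [L HL] := height_compare n; exists L.
suff half u v : Omega u -> Omega v -> (forall j : nat, (j < L)%N -> u j = v j) ->
    height u <= height v + e.
  move=> u v Ou Ov uv; rewrite /transfer; have := half u v Ou Ov uv.
  have := half v u Ov Ou (fun j jL => esym (uv j jL)).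
  by rewrite ler_norml => ? ?; apply/andP; split; lra.
move=> Ou Ov uv; apply: height_le => i.
have [u' [k au]] := address_exists OmegaP n Ou.
have [i2 [i2L]] := HL _ _ _ _ _ _ i au au.
have -> : window u 0 i2 = window v 0 i2.
  by apply: window0_eq => j ji; rewrite uv // (leq_trans ji).
have := height_ge i2 Ov; have := Hn n (leqnn _); rewrite ltr_pdivlMr //.
by have := rhoX n; have := defect_bound_ge0; nra.
Qed.

(** The equality holds up to O(rho^n) for all n: compare an address of u with
    the induced address of S u. *)
Lemma transfer_shift u : Omega u -> transfer (shift u) = transfer u + defect [:: u 0].
Proof.
move=> Ou; have Ou1 : Omega (shift u) by rewrite shiftE;
  exact: (subshift_shiftn OmegaP).
suff H n : `|transfer (shift u) - transfer u - defect [:: u 0]| <= 3 * B * rho ^+ n.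
  by apply/eqP; rewrite -subr_eq0 opprD addrA (geom_le_eq0 rho01 H).
have [v [k au]] := address_exists OmegaP n Ou.
have [Ov kv uE] := au.
have kS : defect (window (iterbi s n v) 0 k.+1) =
    defect (window (iterbi s n v) 0 k) + defect [:: u 0].
  by rewrite -addn1 windowD defect_cat window1 uE.
have Bn : 0 <= B * rho ^+ n by rewrite mulr_ge0 // defect_bound_ge0.
case: (ltnP k.+1 (iterlen s n [:: v 0])) => kv1.
  have au1 : address s Omega n (shift u) v k.+1 by split=> //; rewrite uE shiftnS.
  have := transfer_address au au1 Ou1; have := transfer_address au1 au Ou;
    rewrite kS => ? ?.
  by rewrite ler_norml; apply/andP; split; lra.
have kE : k.+1 = iterlen s n [:: v 0] by apply/eqP; rewrite eqn_leq kv1 kv.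
have au1 : address s Omega n (shift u) (shift v) 0.
  split; first by rewrite shiftE; exact: (subshift_shiftn OmegaP).
    exact: iterlen1_gt0.
  by rewrite shiftn0 iterbi_shift -kE uE shiftnS.
have := transfer_address au au1 Ou1; have := transfer_address au1 au Ou.
rewrite {1 4}/window /= defect_nil => ? ?.
have := defect_window n 1 Ov; rewrite -window_iterbi_right window1 -kE kS ler_norml.
by move=> /andP[? ?]; rewrite ler_norml; apply/andP; split; lra.
Qed.

Lemma transfer_shiftn u k : Omega u ->
  transfer (shiftn k u) = transfer u + defect (window u 0 k).
Proof.
move=> Ou; elim: k => [|k IH]; first by rewrite shiftn0 /window /= defect_nil addr0.
rewrite shiftnS transfer_shift; last exact: (subshift_shiftn OmegaP).
rewrite IH -addrA -defect_cat -(addn1 k) windowD window1 /shiftn.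
by rewrite !add0r.
Qed.

Lemma transfer_iterbi_close n u v : Omega u -> Omega v ->
  `|transfer (iterbi s n u) - transfer (iterbi s n v)| <= 2 * B * rho ^+ n.
Proof.
have half x y : Omega x -> Omega y ->
    transfer (iterbi s n y) <= transfer (iterbi s n x) + 2 * B * rho ^+ n.
  move=> Ox Oy; have ax z : Omega z -> address s Omega n (iterbi s n z) z 0.
    by move=> Oz; split; rewrite ?iterlen1_gt0 ?shiftn0.
  have := transfer_address (ax _ Ox) (ax _ Oy) (subshift_iterbi OmegaP n Oy).
  by rewrite /window /= defect_nil !subr0.
move=> Ou Ov; have := half _ _ Ou Ov; have := half _ _ Ov Ou.
by rewrite ler_norml => ? ?; apply/andP; split; lra.
Qed.

(** * Points with the same values of the transfer function *)

Context (d : nat) (P : {poly int}) (Q : {poly R}) (N : nat).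
Context (pis : pisot_recurrence beta d P Q).
Context (iterlen_rec : forall a n, (N <= n)%N ->
  recur P (fun i => (iterlen s i [:: a])%:Z) n = 0).

Let b1 : 1 < beta. Proof. by case: pis. Qed.
Let b0 : 0 < beta. Proof. exact: lt_trans ltr01 b1. Qed.
Let shO := subshift_shiftn OmegaP.
Let isO := subshift_iterbi OmegaP.

Lemma transfer_iterbi_shiftn i k u : Omega u ->
  transfer (iterbi s i (shiftn k u)) =
    transfer (iterbi s i u) + defect (iterword s i (window u 0 k)).
Proof.
move=> Ou; rewrite iterbi_shiftn transfer_shiftn; last exact: isO.
by rewrite window_iterbi_right.
Qed.

(** On a shifted point the expression changes by the defect recurrence, that
    is not at all since m >= N; so both sides can be computed on the points
    sigma^n(u') and sigma^n(v'), where transfer differs by O(rho^n) only. *)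
Lemma transfer_recur_constant u v m : Omega u -> Omega v -> (N <= m)%N ->
  recur Q (fun i => transfer (iterbi s i u)) m =
  recur Q (fun i => transfer (iterbi s i v)) m.
Proof.
move=> Ou Ov Nm; apply/eqP; rewrite -subr_eq0; apply/eqP.
pose q := \sum_(j < size Q) `|Q`_j|.
apply: (@geom_le_eq0 _ rho (q * (2 * B)) _ rho01) => n.
have shift_n w k : Omega w ->
    recur Q (fun i => transfer (iterbi s i (shiftn k (iterbi s n w)))) m =
    recur Q (fun i => transfer (iterbi s (i + n) w)) m.
  move=> Ow; set z := iterbi s n w; pose g i := defect (iterword s i (window z 0 k)).
  rewrite (@recur_eq _ Q _ (fun i => transfer (iterbi s i z) + g i)) => [|i _];
    last first.
    by rewrite transfer_iterbi_shiftn //; exact: isO.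
  rewrite recur_add (defect_rec pis iterlen_rec) // addr0.
  by apply: recur_eq => i _; rewrite /z -iterbiD.
have [u' [k [Ou' _ ->]]] := address_exists OmegaP n Ou.
have [v' [k' [Ov' _ ->]]] := address_exists OmegaP n Ov.
rewrite !shift_n // -recur_sub /recur (le_trans (ler_norm_sum _ _ _)) // /q -mulrA
  mulr_suml.
apply: ler_sum => j _; rewrite normrM ler_wpM2l //.
apply: (le_trans (transfer_iterbi_close _ Ou' Ov')).
have /andP[r0 r1] := rho01.
have B2 : 0 <= 2 * B by apply: mulr_ge0 => //; exact: defect_bound_ge0.
rewrite ler_wpM2l //.
by rewrite exprD ler_piMl ?exprn_ge0 ?exprn_ile1 // ltW.
Qed.

Lemma transfer_determined u v : Omega u -> Omega v ->
  (forall j, (j < d)%N -> transfer (iterbi s (N + j) u) =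
    transfer (iterbi s (N + j) v)) ->
  forall j, transfer (iterbi s (N + j) u) = transfer (iterbi s (N + j) v).
Proof.
move=> Ou Ov uv j; apply/eqP; rewrite -subr_eq0; apply/eqP.
apply: (@recur_unique _ Q (fun j =>
  transfer (iterbi s (N + j) u) - transfer (iterbi s (N + j) v))).
- exact: pisot_cofactor_monic pis.
- move=> i; rewrite recur_sub (recur_shift Q (fun i => transfer (iterbi s i u))).
  rewrite (recur_shift Q (fun i => transfer (iterbi s i v))).
  by rewrite (transfer_recur_constant Ou Ov) ?subrr // leq_addr.
- by move=> i; rewrite (pisot_cofactor_size pis) /= => /uv->; rewrite subrr.
Qed.

(** The sequence t is the difference of the lengths, indexed from n steps in
    the past. There beta t_j - t_(j+1) coincides with a difference of values
    of transfer on Omega, because both satisfy the recurrence Q and they agree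
    from n on; this bounds t_0 in terms of t_n, which is at most of order
    beta^n, and then t_1, ..., t_d in terms of t_0. *)
Lemma backward_lengths : exists T : nat, forall n u v u' v' k k',
  address s Omega n u u' k -> address s Omega n v v' k' -> u' 0 = v' 0 ->
  Omega u -> Omega v ->
  (forall j, transfer (iterbi s (N + j) u) = transfer (iterbi s (N + j) v)) ->
  exists t : nat -> int,
    [/\ forall i, recur P t i = 0,
        forall i, t (n + i)%N = (iterlen s (N + i) (window (iterbi s n u') 0 k))%:Z
           - (iterlen s (N + i) (window (iterbi s n v') 0 k'))%:Z &
        forall j, (j <= d)%N -> (`|t j| <= T)%N].
Proof.
have [C1 C10 HC1] := iterlen_growth pis iterlen_rec.
have b10 : 0 < beta - 1 by rewrite subr_gt0.
(* The fixed point of x |-> beta x - 2 B, so that |t_(j+1)| >= beta |t_j| - 2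
   B reads |t_(j+1)| - c >= beta (|t_j| - c), and similarly with the upper
   bound. *)
pose c := 2 * B / (beta - 1).
have B0 : 0 <= B by apply: defect_bound_ge0.
have c0 : 0 <= c by apply: divr_ge0; [exact: mulr_ge0|exact: ltW].
have cE : c * beta = c + 2 * B by rewrite /c; field; rewrite subr_eq0 gt_eqF.
pose T := beta ^+ d * (c + C1 * beta ^+ N + c).
exists (Num.bound T) => n u v u' v' k k' [Ou' ku' uE] [Ov' kv' vE] uv0 Ou Ov uv.
set p := window (iterbi s n u') 0 k; set p' := window (iterbi s n v') 0 k'.
have [_ mP sP uP PQ _] := pis.
pose S i := (iterlen s (N + i) p)%:Z - (iterlen s (N + i) p')%:Z.
have [i|t tS tP] := @recur_extend_back _ P S n uP.
  rewrite recur_sub (recur_shift P (fun i => (iterlen s i p)%:Z)).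
  rewrite (recur_shift P (fun i => (iterlen s i p')%:Z)).
  by rewrite !(iterlen_word_rec iterlen_rec) ?subrr // leq_addr.
pose y i : R := beta * (t i)%:~R - (t i.+1)%:~R.
pose eta i := transfer (iterbi s (N + i) v') - transfer (iterbi s (N + i) u').
have yQ i : recur Q y i = 0 by rewrite (recur_pisot pis) tP oppr0.
have etaQ i : recur Q eta i = 0.
  rewrite recur_sub (recur_shift Q (fun i => transfer (iterbi s i v'))).
  rewrite (recur_shift Q (fun i => transfer (iterbi s i u'))).
  by rewrite (transfer_recur_constant Ou' Ov') ?subrr // leq_addr.
have yeta i : y i = eta i.
  apply/eqP; rewrite -subr_eq0; apply/eqP.
  apply: (@recur_unique_back _ Q (fun i => y i - eta i) n (pisot_cofactor_unit pis)).
    by move=> l; rewrite recur_sub yQ etaQ subrr.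
  move=> l nl; rewrite -(subnKC nl); move: (l - n)%N => {nl}l.
  have := uv l; rewrite uE vE !transfer_iterbi_shiftn; try exact: isO;
    rewrite -/p -/p' -!iterbiD !defect_iterwordE.
  rewrite /y /eta -[(n + l).+1]addnS !tS /S [(N + l.+1)%N]addnS.
  rewrite !rmorphB /= addnCA [(n + (N + l))%N]addnC.
  lra.
have y2B i : `|y i| <= 2 * B.
  have := transfer_bounded (isO (N + i) Ov').
  have := transfer_bounded (isO (N + i) Ou').
  rewrite yeta /eta !ler_norml => /andP[? ?] /andP[? ?].
  by apply/andP; split; lra.
have tS1 i : (t i.+1)%:~R = beta * (t i)%:~R - y i by rewrite /y; lra.
have tn : `|(t n)%:~R : R| <= C1 * beta ^+ N * beta ^+ n.
  have pE (w : biinfinite A) l : (l < iterlen s n [:: w 0])%N ->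
    (iterlen s N (window (iterbi s n w) 0 l) <= iterlen s (N + n) [:: w 0%Z])%N.
    move=> lw; have := window_iterbi_right s n w 1;
      rewrite window1 -(subnKC (ltnW lw)) windowD => wE.
    by rewrite iterlenD -wE iterlen_cat leq_addr.
  have b := HC1 (N + n)%N (u' 0); rewrite exprD mulrA in b; apply: le_trans b.
  rewrite -[n in t n]addn0 tS /S addn0 -intr_norm pmulrn ler_int.
  have := pE u' k ku'; have := pE v' k' kv'; rewrite -uv0 -/p -/p'.
  by set e := iterlen s (N + n) _;
    move: (iterlen s N p) (iterlen s N p') e => a1 a2 a3; lia.
have low i : beta ^+ i * (`|(t 0)%:~R| - c) <= `|(t i)%:~R : R| - c.
  elim: i => [|i IH]; first by rewrite expr0 mul1r.
  have : beta * `|(t i)%:~R : R| - 2 * B <= `|(t i.+1)%:~R : R|.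
    rewrite tS1; apply: le_trans (lerB_dist _ _); rewrite normrM (gtr0_norm b0).
    by have := y2B i; lra.
  have := ler_wpM2l (ltW b0) IH; rewrite exprS -mulrA.
  by move=> h1 h2; lra.
have t0 : `|(t 0)%:~R : R| <= c + C1 * beta ^+ N.
  rewrite -lerBlDl -(ler_pM2l (exprn_gt0 n b0)) mulrC [beta ^+ n * _]mulrC.
  by apply: le_trans tn; apply: (le_trans (_ : _ <= `|(t n)%:~R| - c));
    [rewrite mulrC; exact: low|lra].
have up i : `|(t i)%:~R : R| + c <= beta ^+ i * (`|(t 0)%:~R| + c).
  elim: i => [|i IH]; first by rewrite expr0 mul1r.
  have : `|(t i.+1)%:~R : R| <= beta * `|(t i)%:~R : R| + 2 * B.
    rewrite tS1 (le_trans (ler_normB _ _)) // normrM (gtr0_norm b0).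
    by have := y2B i; lra.
  have := ler_wpM2l (ltW b0) IH; rewrite exprS -mulrA.
  by move=> h1 h2; lra.
exists t; split=> // j jd.
have T0 : 0 <= T.
  apply: mulr_ge0; first exact: exprn_ge0 (ltW b0).
  apply: addr_ge0 => //; apply: addr_ge0 => //.
  by apply: mulr_ge0 => //; exact: exprn_ge0 (ltW b0).
have : `|(t j)%:~R : R| <= T.
  apply: (@le_trans _ _ (beta ^+ j * (`|(t 0)%:~R| + c))); first by have := up j; lra.
  rewrite /T ler_pM ?addr_ge0 ?exprn_ge0 ?(ltW b0) //.
    by rewrite ler_weXn2l // ltW.
  by rewrite lerD2r.
move=> tT; have := le_lt_trans tT (archi_boundP T0); rewrite -intr_norm pmulrn ltr_int.
by rewrite -abszE ltz_nat; exact: ltnW.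
Qed.

Context (prop : proper_subst s).

(** For each n, a point of the fibre is encoded by the first letter of its
    level-n desubstitution and by the backward length differences to a
    reference point with the same letter; the code determines the address, and
    the number of codes does not depend on n. *)
Lemma transfer_fibre_finite (x : nat -> R) :
  finite_set [set u | Omega u /\
    forall j, (j < d)%N -> transfer (iterbi s (N + j) u) = x j].
Proof.
set U := [set u | _].
have [T HT] := backward_lengths.
have lenoo := iterlen_unbounded pis rho01 C0 defect_decay.
apply: (@finite_set_separated _ _ (A * {ffun 'I_d.+1 -> 'I_(T + T).+1})%type) => L.
have [n0 Hn0] := address_agreement Omega prop lenoo L.
have Uphi u v : U u -> U v -> forall j, transfer (iterbi s (N + j) u) =
  transfer (iterbi s (N + j) v).
  move=> [Ou ux] [Ov vx]; apply: transfer_determined => //.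
  by move=> j jd; rewrite ux // vx.
have /choice[adr adrP] : forall u, exists a : biinfinite A * nat,
    Omega u -> address s Omega n0 u a.1 a.2.
  move=> u; have [Ou|nO] := pselect (Omega u); last by exists (u, 0%N).
  by have [u' [k a]] := address_exists OmegaP n0 Ou; exists (u', k).
(* One reference point in the fibre for each letter that occurs. *)
have /choice[ref refP] : forall b, exists v, forall u, U u -> (adr u).1 0 = b ->
    U v /\ (adr v).1 0 = b.
  move=> b; have [[v [Uv vb]]|nv] := pselect (exists v, U v /\ (adr v).1 0 = b).
    by exists v.
  have [v _] : exists v, Omega v by have [[[v Ov] _ _ _] _] := OmegaP; exists v.
  by exists v => u Uu ub; exfalso; apply: nv; exists u.
pose r u := ref ((adr u).1 0).
pose pre u := window (iterbi s n0 (adr u).1) 0 (adr u).2.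
have /choice[t tP] : forall u, exists t : nat -> int, U u ->
   [/\ forall i, recur P t i = 0,
        forall i, t (n0 + i)%N = (iterlen s (N + i) (pre u))%:Z
           - (iterlen s (N + i) (pre (r u)))%:Z &
        forall j, (j <= d)%N -> (`|t j| <= T)%N].
  move=> u; have [Uu|nU] := pselect (U u); last by exists (fun=> 0).
  have [Ur ru] := refP _ u Uu erefl.
  have [Ou _] := Uu; have [Or _] := Ur.
  have [t tP] := HT n0 u (r u) _ _ _ _ (adrP u Ou) (adrP _ Or) (esym ru) Ou Or
    (Uphi _ _ Uu Ur).
  by exists t.
(* The differences lie in [-T, T]; they are shifted by T to become natural
   numbers. *)
exists (fun u => ((adr u).1 0, [ffun j : 'I_d.+1 => inord (absz (t u j + T%:Z))])) =>
  u v Uu Uv.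
move=> [uvE tE]; have [tu1 tu2 tu3] := tP u Uu; have [tv1 tv2 tv3] := tP v Uv.
have tuv j : (j <= d)%N -> t u j = t v j.
  move=> jd.
  have := congr1 (fun f : {ffun 'I_d.+1 -> 'I_(T + T).+1} => val (f (inord j))) tE.
  rewrite !ffunE /= !inordK //; have := tu3 j jd; have := tv3 j jd; lia.
have [_ mP sP _ _ _] := pis.
have {}tuv j : t u j = t v j.
  apply/eqP; rewrite -subr_eq0; apply/eqP.
  apply: (@recur_unique _ P (fun j => t u j - t v j)) => // [i|i].
    by rewrite recur_sub tu1 tv1 subrr.
  by rewrite sP /= ltnS => id; rewrite tuv // subrr.
have iterlenE : iterlen s N (pre u) = iterlen s N (pre v).
  have := tuv (n0 + 0)%N; rewrite tu2 tv2 addn0 /r uvE => /addIr; by case.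
have [Ou _] := Uu; have [Ov _] := Uv.
have au := adrP u Ou; have av := adrP v Ov; have [_ ku _] := au; have [_ kv _] := av.
have preE w : ((adr w).2 < iterlen s n0 [:: (adr w).1 0%Z])%N ->
    pre w = take (adr w).2 (iterword s n0 [:: (adr w).1 0%Z]).
  move=> kw; have := window_iterbi_right s n0 (adr w).1 1.
  rewrite window1 -{1}(subnKC (ltnW kw)) windowD => <-.
  by rewrite take_size_cat // size_window.
have kE : (adr u).2 = (adr v).2.
  move: iterlenE; rewrite (preE u) // (preE v) // -uvE; apply: take_iterlen_inj;
    first exact: ltnW.
  by rewrite uvE; exact: ltnW.
by apply: (Hn0 n0 u v (adr u).1 (adr v).1 (adr u).2) => //; rewrite kE.
Qed.

(** * The factor map *)

Let beta_ge0 : 0 <= beta. Proof. exact: ltW. Qed.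

Definition transfer_coord u i := horner_sum beta (fun j => transfer (iterbi s j u)) i.
Definition factor_map u : torus R d := to_torus (\row_(i < d) transfer_coord u i).

Lemma transfer_coord_shift u i : Omega u ->
  transfer_coord (shift u) i = transfer_coord u i +
    beta ^+ i.+1 - (iterlen s i.+1 [:: u 0])%:R.
Proof.
move=> Ou; have := horner_sum_telescope beta (fun j => (iterlen s j [:: u 0])%:Z%:~R) i.
rewrite /= mulr1 => telE.
have -> : transfer_coord (shift u) i = transfer_coord u i +
    horner_sum beta (fun j =>
      beta * (iterlen s j [:: u 0])%:Z%:~R - (iterlen s j.+1 [:: u 0])%:Z%:~R) i.
  rewrite addrC; apply/eqP; rewrite -subr_eq /transfer_coord -horner_sumB;
    apply/eqP/horner_sum_eq => j _.
  rewrite shiftE transfer_iterbi_shiftn // window1.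
  by rewrite -defect_iterwordE addrAC subrr add0r.
by rewrite telE addrA -pmulrn.
Qed.

Lemma transfer_coord_bounded u i : Omega u ->
  `|transfer_coord u i| <= B * horner_sum beta (fun=> 1) i.
Proof.
move=> Ou; apply: horner_sum_le => // j _.
exact: (transfer_bounded (subshift_iterbi OmegaP _ Ou)).
Qed.

Lemma iterbi_agree n u v L : (forall j : nat, (j < L)%N -> u j = v j) ->
  forall j : nat, (j < L)%N -> iterbi s n u j = iterbi s n v j.
Proof.
move=> uv j jL; have E := window_iterbi_right s n u L.
rewrite (window0_eq uv) -window_iterbi_right in E.
apply: (window_eqE E); rewrite add0r /=.
have := iterlen_ge s (window v 0 L) n; rewrite size_window => /(leq_trans jL).
by rewrite ltz_nat.
Qed.

Lemma transfer_coord_uniformly_continuous i e : 0 < e -> exists L, forall u v,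
  Omega u -> Omega v -> (forall j : nat, (j < L)%N -> u j = v j) ->
  `|transfer_coord u i - transfer_coord v i| <= e.
Proof.
have transferUC j e' : 0 < e' -> exists L, forall u v, Omega u -> Omega v ->
    (forall l : nat, (l < L)%N -> u l = v l) ->
    `|transfer (iterbi s j u) - transfer (iterbi s j v)| <= e'.
  move=> /transfer_uniformly_continuous[L HL].
  exists L => u v Ou Ov uv; apply: HL; try exact: subshift_iterbi.
  exact: iterbi_agree.
elim: i e => [|i IH] e e0; first exact: transferUC.
have bp : 0 < 2 * (beta + 1) by have := beta_ge0; lra.
have [L1 H1] := IH _ (divr_gt0 e0 bp).
have e2 : 0 < e / 2 by lra.
have [L2 H2] := transferUC i.+1 _ e2.
exists (maxn L1 L2) => u v Ou Ov uv; rewrite /transfer_coord /=.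
have h1 := H1 u v Ou Ov (fun j jL => uv j (leq_trans jL (leq_maxl _ _))).
have h2 := H2 u v Ou Ov (fun j jL => uv j (leq_trans jL (leq_maxr _ _))).
rewrite opprD addrACA -mulrBr (le_trans (ler_normD _ _)) // normrM (ger0_norm beta_ge0).
have : beta * (e / (2 * (beta + 1))) <= e / 2.
  have -> : e / 2 = beta * (e / (2 * (beta + 1))) + e / (2 * (beta + 1)).
    by field; rewrite gt_eqF //; have := beta_ge0; lra.
  by rewrite lerDl ltW // divr_gt0.
have := ler_wpM2l beta_ge0 h1; move: h2; rewrite /transfer_coord /=; lra.
Qed.

Lemma factor_map_continuous : {within Omega, continuous factor_map}.
Proof.
apply/subspace_continuousP => u Ou.
pose F v : 'rV[R]_d := \row_(i < d) transfer_coord v i.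
apply: (@cvg_comp _ _ _ F to_torus _ (nbhs (F u))); last exact: to_torus_continuous.
apply/cvg_ballP => e e0.
have /choice[L HL] := fun i : 'I_d =>
  transfer_coord_uniformly_continuous i (divr_gt0 e0 (ltr0n R 2)).
pose ctr := [seq Posz k | k <- iota 0 (\max_(j < d) L j)].
have agree v : [set v | forall k, k \in ctr -> v k = u k] v -> Omega v ->
    ball (F u) e (F v).
  move=> vu Ov; split=> // i j; rewrite /F /ball /= !mxE.
  apply: (@le_lt_trans _ _ (e / 2)); last by lra.
  apply: HL => // l lL; rewrite vu // map_f // mem_iota /= add0n (leq_trans lL) //.
  exact: (leq_bigmax (F := L)).
exact: filterS agree (nbhs_cylinder u ctr).
Qed.

Lemma factor_map_shift u : Omega u ->
  factor_map (shift u) = factor_map u + to_torus (\row_(i < d) beta ^+ i.+1).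
Proof.
move=> Ou; rewrite /factor_map -to_torusD; apply/to_torus_eq => i.
rewrite !mxE transfer_coord_shift // addrAC subrr sub0r rpredN.
exact: natr_int.
Qed.

(** The coordinates of a point of the fibre take finitely many real values,
    being bounded and prescribed modulo 1. Together with the address at level
    N they prescribe transfer on the images under sigma^N, ..., sigma^(N+d-1)
    of the desubstituted point, so [transfer_fibre_finite] applies. *)
Lemma factor_map_fibre_finite y : finite_set (Omega `&` factor_map @^-1` [set y]).
Proof.
pose yr : 'rV[R]_d := repr y.
pose kmax := (\max_a iterlen s N [:: a])%N.
pose b : R := \sum_(i < d) (B * horner_sum beta (fun=> 1) i + `|yr 0 i|).
have B0 : 0 <= B by exact: defect_bound_ge0.
have bi (i : 'I_d) : 0 <= B * horner_sum beta (fun=> 1) i + `|yr 0 i|.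
  by apply: addr_ge0 => //; apply: mulr_ge0 => //; exact: horner_sum1_ge0.
have b00 : 0 <= b by apply: sumr_ge0.
(* The coordinates of a point of the fibre differ from those of yr by integers
   in [-Mb, Mb]. *)
pose Mb := Num.bound b.
pose T : finType := ({ffun 'I_d -> 'I_(Mb + Mb).+1} * A * 'I_kmax.+1)%type.
pose x (c : T) (j : nat) : R :=
  horner_diff beta (fun i =>
    if insub i is Some i' then yr 0 i' + (c.1.1 i' : nat)%:R - Mb%:R else 0) j
  - defect (iterword s j (take c.2 (iterword s N [:: c.1.2]))).
pose U (c : T) := [set u | Omega u /\ forall j, (j < d)%N ->
  transfer (iterbi s (N + j) u) = x c j].
apply: (@sub_finite_set _ _ (\bigcup_(c in [set: T]) ((fun u =>
  shiftn c.2 (iterbi s N u)) @` U c))); last first.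
  apply: bigcup_finite => [|c _]; first exact: finite_finset.
  apply: finite_image.
  exact: transfer_fibre_finite.
move=> u [Ou /= uy].
have [v [k [Ov kv uE]]] := address_exists OmegaP N Ou.
have kK : (k < kmax.+1)%N.
  by rewrite ltnS (leq_trans (ltnW kv)) //;
    exact: (leq_bigmax (F := fun a => iterlen s N [:: a])).
have ucoord : to_torus (\row_(i < d) transfer_coord u i) = to_torus yr
  by rewrite [RHS]to_torus_repr.
have /choice[m mE] : forall i : 'I_d, exists m : 'I_(Mb + Mb).+1,
    transfer_coord u i = yr 0 i + m%:R - Mb%:R.
  move=> i; have /to_torus_eq/(_ i) := ucoord; rewrite mxE => /intrP[z zE].
  have zb : `|z%:~R : R| <= b.
    rewrite -zE (le_trans (ler_normB _ _)) // /b (bigD1 i) //=.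
    rewrite -[X in X <= _]addr0; apply: lerD; last by apply: sumr_ge0.
    by rewrite lerD2r transfer_coord_bounded.
  have zM : (absz z <= Mb)%N.
    have := le_lt_trans zb (archi_boundP b00); rewrite -intr_norm pmulrn ltr_int.
    by rewrite -abszE ltz_nat; exact: ltnW.
  exists (inord (absz (z + Posz Mb)%R)).
  have zMb : (absz (z + Posz Mb)%R < (Mb + Mb).+1)%N by move: zM; move: (Mb) => n; lia.
  rewrite inordK // pmulrn gez0_abs; last by move: zM; move: (Mb) => n; lia.
  rewrite intrD -pmulrn -zE; ring.
exists ([ffun i => m i], v 0, Ordinal kK) => //; exists v => //=.
split=> // j jd; rewrite /x /=.
have wE : take k (iterword s N [:: v 0%Z]) = window (iterbi s N v) 0 k.
  have := window_iterbi_right s N v 1;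
    rewrite window1 -{1}(subnKC (ltnW kv)) windowD => <-.
  by rewrite take_size_cat // size_window.
rewrite wE; have := horner_sumK beta (fun j => transfer (iterbi s j u)) j.
rewrite {2}uE transfer_iterbi_shiftn ?subshift_iterbi //; last exact: subshift_iterbi.
rewrite -iterbiD [(j + N)%N]addnC => transferE; apply/eqP;
  rewrite eq_sym subr_eq -transferE; apply/eqP.
have coordE i : (i < d)%N -> horner_sum beta (fun j => transfer (iterbi s j u)) i =
   if insub i is Some i' then yr 0 i' + ([ffun i => m i] i' : nat)%:R - Mb%:R else 0.
  by move=> id; rewrite insubT /= ffunE -mE.
by apply: horner_diff_eq => i ij; rewrite coordE // (leq_ltn_trans ij).
Qed.

End Transfer.

Lemma torus_null_set0 (R : realType) d (E : set (torus R d)) : E `<=` set0 ->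
  torus_null E.
Proof.
move=> E0 e e0; exists set0, (fun=> 0), (fun=> 0); split=> //.
- by move=> x [_ /E0].
- by rewrite esum_set0 lee_fin ltW.
Qed.

Theorem theorem1p2 (R : realType) (A : finType) (sigma : substitution A)
    (beta : R) (d : nat) (Omega : set (biinfinite A)) :
  let M : 'M[R[i]]_#|A| := complex_mx (incidence_matrix sigma) in
  proper_subst sigma ->
  primitive_subst sigma ->
  pseudo_unimodular R sigma ->
  perron_eigenvalue M beta ->
  pisot beta ->
  algebraic_degree beta d.+1 ->
  (forall z : R[i], eigenvalue M z -> 1 <= `|z| -> z != beta%:C ->
     forall v : 'cV[R[i]]_#|A|, generalized_eigenvector M z v ->
       \sum_a v a 0 = 0) ->
  substitution_subshift sigma Omega ->
  finite_extension_of_minimal_translation R d Omega.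
Proof.
move=> M prop prim unim perron pis deg sum0 OmegaP.
have [P [Q [pisPQ [N recN]]]] := pisot_matrix_recurrence unim perron pis deg sum0.
have iterlen_rec a n : (N <= n)%N ->
  recur P (fun i => (iterlen sigma i [:: a])%:Z) n = 0.
  move=> Nn; rewrite -(recN n (enum_rank a) Nn).
  by apply: recur_eq => j _; exact: iterlen_mx.
have [C [rho [C0 rho01 kC]]] := defect_decays pisPQ iterlen_rec.
exists (factor_map sigma beta d), (to_torus (\row_(i < d) beta ^+ i.+1)); split.
- split; first exact: (factor_map_continuous OmegaP prim C0 rho01 kC pisPQ).
  by move=> u Ou; exact: (factor_map_shift OmegaP prim C0 rho01 kC d Ou).
- exact: powers_minimal_translation pisPQ.
- apply: torus_null_set0 => y /=; apply.
  exact: (factor_map_fibre_finite OmegaP prim C0 rho01 kC pisPQ iterlen_rec prop).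
Qed.
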